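(* Let $\psi$ be a weak linear order of $V=[n]$ and let $A\in\mathcal S^n$ be a nonnegative matrix ordered compatibly with $\psi$. Run the procedure Robinson$(A,\psi)$ described in the context. (i) If it terminates, then there exist straight enumerations $\phi^{(1)},\dots,\phi^{(L)}$ of the level graphs $G^{(1)},\dots,G^{(L)}$ of $A$ such that the returned weak linear order $\Phi$ is compatible with each of them and with $\psi$. (ii) If it stops (reports failure), then there do not exist straight enumerations of the level graphs of $A$ that are pairwise compatible and compatible with $\psi$.
   Context: Weak linear orders are ordered partitions of $V$; compatibility of two weak linear orders $\psi_1,\psi_2$ means no $x,y$ with $x<_{\psi_1}y$, $y<_{\psi_2}x$; $\psi_1\wedge\psi_2$ is their common refinement ($x=y$ iff equal in both; $x<y$ iff $\le$ in both with one strict); $\overline\phi$ is the reversal of $\phi$; $\psi[U]$ is restriction; $(\cdot,\cdot)$ is concatenation. If $0=\alpha_0<\alpha_1<\dots<\alpha_L$ are the distinct values of the entries of nonnegative $A$ (0 included), the $\ell$-th level graph $G^{(\ell)}$ on $[n]$ has edges $\{x,y\}$, $x\ne y$, with $A_{xy}\ge\alpha_\ell$; $G^{(1)}$ is the support graph. Blocks of a graph: classes of $N[x]=N[y]$ (closed neighborhoods); distinct blocks are adjacent if some of their vertices are adjacent; a straight enumeration is a linear order of the blocks in which each block and the blocks adjacent to it are consecutive (a connected graph has at most one up to reversal). Procedure Robinson$(A,\psi)$: let $G$ be the support graph of $A$. Call CO-Lex-BFS$(G,\psi)$, which either stops (failure) or returns an order $V_1,\dots,V_c$ of the connected components with $V_1\le_\psi\dots\le_\psi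 V_c$ (and stops only if no such order exists). Set $\Phi=\emptyset$. For $\omega=1,\dots,c$: compute a straight enumeration $\phi_\omega$ of $G[V_\omega]$, stopping (failure) if none exists; set $\Phi_\omega=\psi[V_\omega]\wedge\phi_\omega$ if these are compatible, else $\Phi_\omega=\psi[V_\omega]\wedge\overline{\phi}_\omega$ if compatible, else stop (failure). Let $A'[V_\omega]$ be obtained from the principal submatrix $A[V_\omega]$ by setting its entries equal to its smallest nonzero entry to $0$. If $A'[V_\omega]$ has all off-diagonal entries zero, set $\Phi=(\Phi,\Phi_\omega)$; otherwise set $\Phi=(\Phi,\mathrm{Robinson}(A'[V_\omega],\Phi_\omega))$ (failure of the recursive call is failure of the whole procedure). Return $\Phi$. *)

(* Defs.v *)
From HB Require Import structures.
From mathcomp Require Import all_boot all_order all_algebra zify.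
From Stdlib Require Import Classical.
Set Implicit Arguments.
Unset Strict Implicit.
Unset Printing Implicit Defensive.
Import Order.TTheory GRing.Theory Num.Theory.

Section WeakLinearOrders.
Variable T : finType.
Implicit Types (U V W : {set T}) (psi phi : seq {set T}) (x y : T).

Definition weak_linear_order U psi : bool :=
  uniq psi && partition [set B in psi] U.

(* The position of the class of x; only meaningful for x in the ground set of
   psi (it is size psi otherwise). *)
Definition rank psi x : nat := find (fun B : {set T} => x \in B) psi.

Definition wlt psi x y : bool := rank psi x < rank psi y.
Definition wle psi x y : bool := rank psi x <= rank psi y.
Definition weq psi x y : bool := rank psi x == rank psi y.

Definition set_wle psi V W : bool := [forall x in V, forall y in W, wle psi x y].

Definition compatible U psi1 psi2 : bool :=
  [forall x in U, forall y in U, ~~ (wlt psi1 x y && wlt psi2 y x)].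

Definition restrict psi U : seq {set T} :=
  [seq B :&: U | B <- psi & B :&: U != set0].

(* The common refinement of two compatible weak linear orders: being
   compatible, it can be listed lexicographically. The lemmas meet_wlo,
   meet_weq and meet_wlt below give its usual characterization. *)
Definition meet psi1 psi2 : seq {set T} :=
  [seq B <- [seq B1 :&: B2 | B1 <- psi1, B2 <- psi2] | B != set0].

Lemma find_filter_count (X : Type) (a p : pred X) (s : seq X) :
  subpred a p -> find a (filter p s) = count p (take (find a s) s).
Proof.
move=> ap; elim: s => //= z s IH.
by case az: (a z) => /=; [rewrite ap //= az | case: (p z) => /=; rewrite ?az IH].
Qed.

Lemma ltn_find_filter (X : Type) (a b p : pred X) (s : seq X) :
  subpred a p -> subpred b p ->
  (find a (filter p s) < find b (filter p s)) = (find a s < find b s).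
Proof.
have aux (c d : pred X) : find c s <= find d s ->
    count p (take (find c s) s) <= count p (take (find d s) s).
  by move=> cd; rewrite -(subnKC cd) takeD count_cat leq_addr.
move=> ap bp; rewrite !find_filter_count //.
case: (ltnP (find a s) (find b s)) => ab; last by rewrite ltnNge aux.
have has_a : has a s by rewrite has_find (leq_trans ab) ?find_size.
case: s ab has_a {aux} => // z0 s ab has_a.
rewrite -(subnKC ab) takeD count_cat (take_nth z0) -?has_find //.
by rewrite -cats1 count_cat /= ap ?nth_find //; lia.
Qed.

Lemma rank_meet_pairs psi1 psi2 x : rank psi1 x < size psi1 ->
  rank psi2 x < size psi2 ->
  rank [seq B1 :&: B2 | B1 <- psi1, B2 <- psi2] x =
  rank psi1 x * size psi2 + rank psi2 x.
Proof.
rewrite /rank; move=> + lt2; elim: psi1 => //= B psi1 IH.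
rewrite find_cat has_map size_map find_map.
case xB: (x \in B) => lt1.
  have E : preim (setI B) (fun C : {set T} => x \in C) =1 (fun C => x \in C).
    by move=> C; rewrite /= inE xB.
  by rewrite (eq_has E) (eq_find E) has_find lt2 mul0n.
have E : preim (setI B) (fun C : {set T} => x \in C) =1 pred0.
  by move=> C; rewrite /= inE xB.
by rewrite (eq_has E) has_pred0 IH // mulSn addnA.
Qed.

Lemma wlt_meet_lex psi1 psi2 x y :
  rank psi1 x < size psi1 -> rank psi2 x < size psi2 ->
  rank psi1 y < size psi1 -> rank psi2 y < size psi2 ->
  wlt (meet psi1 psi2) x y =
  wlt psi1 x y || (weq psi1 x y && wlt psi2 x y).
Proof.
move=> x1 x2 y1 y2; rewrite /wlt /weq /meet {1 2}/rank ltn_find_filter.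
- by rewrite -!/(rank _ _) !rank_meet_pairs //; nia.
- by move=> B xB; apply/set0Pn; exists x.
- by move=> B yB; apply/set0Pn; exists y.
Qed.

Lemma rank_ltn U psi x : weak_linear_order U psi -> x \in U ->
  rank psi x < size psi.
Proof.
case/andP=> _ /and3P[/eqP cov _ _]; rewrite -cov => /bigcupP[B].
by rewrite inE => Bpsi xB; rewrite -has_find; apply/hasP; exists B.
Qed.

Lemma meet_wlt U psi1 psi2 x y :
  weak_linear_order U psi1 -> weak_linear_order U psi2 ->
  compatible U psi1 psi2 -> x \in U -> y \in U ->
  wlt (meet psi1 psi2) x y =
  [&& wle psi1 x y, wle psi2 x y & wlt psi1 x y || wlt psi2 x y].
Proof.
move=> w1 w2 /forall_inP cmp xU yU.
have /forall_inP/(_ _ yU) := cmp _ xU; have /forall_inP/(_ _ xU) := cmp _ yU.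
rewrite wlt_meet_lex ?(rank_ltn w1) ?(rank_ltn w2) // /wlt /wle /weq; lia.
Qed.

Lemma meet_weq U psi1 psi2 x y :
  weak_linear_order U psi1 -> weak_linear_order U psi2 -> x \in U -> y \in U ->
  weq (meet psi1 psi2) x y = weq psi1 x y && weq psi2 x y.
Proof.
move=> w1 w2 xU yU.
have E a : weq a x y = ~~ wlt a x y && ~~ wlt a y x.
  by rewrite /weq /wlt; lia.
rewrite [LHS]E !wlt_meet_lex ?(rank_ltn w1) ?(rank_ltn w2) //.
rewrite /wlt /weq; lia.
Qed.

Lemma meet_wlo U psi1 psi2 :
  weak_linear_order U psi1 -> weak_linear_order U psi2 ->
  weak_linear_order U (meet psi1 psi2).
Proof.
move=> /andP[u1 /and3P[/eqP c1 /trivIsetP t1 _]].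
move=> /andP[u2 /and3P[/eqP c2 /trivIsetP t2 _]].
have uniq_class (s : seq {set T}) (t : {in [set B in s] &, forall B C : {set T}, B != C ->
   [disjoint B & C]}) B C z : B \in s -> C \in s -> z \in B -> z \in C -> B = C.
  move=> Bs Cs zB zC; apply/eqP/negPn/negP => /t.
  rewrite !inE Bs Cs => /(_ isT isT) /disjointFr/(_ zB).
  by rewrite zC.
have inj (B1 B2 C1 C2 : {set T}) z : B1 \in psi1 -> C1 \in psi1 -> B2 \in psi2 ->
    C2 \in psi2 -> z \in B1 :&: B2 -> z \in C1 :&: C2 -> (B1, B2) = (C1, C2).
  move=> ? ? ? ? /setIP[? ?] /setIP[? ?].
  by rewrite (uniq_class psi1 t1 B1 C1 z) // (uniq_class psi2 t2 B2 C2 z).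
apply/andP; split.
  have -> : meet psi1 psi2 = [seq B <- [seq p.1 :&: p.2 | p <- [seq (B, C) | B <- psi1, C <- psi2]] | B != set0].
    by rewrite map_allpairs.
  rewrite filter_map map_inj_in_uniq; last first.
    move=> p q; rewrite !mem_filter => /andP[/set0Pn[z zp]].
    case/allpairsP=> -[B1 B2] /= [? ? ep] /andP[_].
    case/allpairsP=> -[C1 C2] /= [? ? eq] E; subst p q.
    by apply: (inj _ _ _ _ z) => //; rewrite -E.
  by apply/filter_uniq/allpairs_uniq => // -[? ?] [? ?] _ _ /= [-> ->].
apply/and3P; split.
- apply/eqP/setP => z; apply/bigcupP/idP => [[B]|zU].
    rewrite inE mem_filter => /andP[_ /allpairsP[[B1 B2] /= [B1s _ ->]]].
    by case/setIP=> zB1 _; rewrite -c1; apply/bigcupP; exists B1; rewrite ?inE.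
  have /bigcupP[B1] : z \in cover [set B in psi1] by rewrite c1.
  have /bigcupP[B2] : z \in cover [set B in psi2] by rewrite c2.
  rewrite !inE => ? ? ? ?; exists (B1 :&: B2); last by rewrite inE; apply/andP.
  rewrite inE mem_filter; apply/andP; split.
    by apply/set0Pn; exists z; rewrite inE; apply/andP.
  by apply/allpairsP; exists (B1, B2).
- apply/trivIsetP => B C; rewrite !inE !mem_filter.
  move=> /andP[_ /allpairsP[[B1 B2] /= [? ? ->]]].
  move=> /andP[_ /allpairsP[[C1 C2] /= [? ? ->]]].
  apply: contraR => /pred0Pn[z /andP[/= zB zC]].
  have [-> ->] : (B1, B2) = (C1, C2) by apply: (inj _ _ _ _ z).
  exact: eqxx.
- by rewrite inE mem_filter eqxx.
Qed.

End WeakLinearOrders.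

(* A graph is given by a vertex set U and an adjacency relation e, of which
   only the restriction to U matters. *)
Section Graphs.
Variable T : finType.
Implicit Types (U V B C : {set T}) (e : rel T) (psi phi cs : seq {set T}).

Definition closed_nbh U e (x : T) : {set T} :=
  [set y in U | (y == x) || e x y].

Definition blocks U e : {set {set T}} :=
  equivalence_partition [rel x y | closed_nbh U e x == closed_nbh U e y] U.

Definition adjacent_or_eq e B C : bool :=
  (B == C) || [exists x in B, exists y in C, e x y].

Definition straight_enumeration U e phi : Prop :=
  [/\ uniq phi, [set B in phi] = blocks U e &
      forall B i j k, B \in phi -> i < j < k -> k < size phi ->
        adjacent_or_eq e B (nth set0 phi i) ->
        adjacent_or_eq e B (nth set0 phi k) ->
        adjacent_or_eq e B (nth set0 phi j)].

Definition components U e : {set {set T}} :=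
  equivalence_partition
    (connect [rel x y | [&& x \in U, y \in U & e x y]]) U.

Definition component_order U e psi cs : Prop :=
  [/\ uniq cs, [set V in cs] = components U e & pairwise (set_wle psi) cs].

End Graphs.

Section Robinson.
Variables (R : realFieldType) (n : nat).
Implicit Types (A : 'M[R]_n) (U V : {set 'I_n}).
Implicit Types (psi phi Phi cs : seq {set 'I_n}) (r : option (seq {set 'I_n})).
Local Open Scope ring_scope.

(* The sequence alpha_0 < ... < alpha_L of the distinct values, 0 included, of
   the entries (diagonal ones too) of the principal submatrix A[U]. *)
Definition levels U A : seq R :=
  sort <=%R (undup (0 :: [seq A x y | x <- enum U, y <- enum U])).

Definition level U A (l : nat) : R := (levels U A)`_l.

Definition max_level U A : nat := (size (levels U A)).-1.

Definition level_graph U A (l : nat) : rel 'I_n :=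
  [rel x y | (x != y) && (level U A l <= A x y)].

Definition support_graph A : rel 'I_n := [rel x y | (x != y) && (A x y != 0)].

(* For a nonnegative A, level V A 1 is the smallest nonzero entry of A[V] when
   A[V] != 0, and the default value 0 when A[V] = 0. Only the entries of the
   result in V x V are meaningful. *)
Definition peel V A : 'M[R]_n :=
  \matrix_(x, y) if A x y == level V A 1 then 0 else A x y.

Definition off_diagonal_zero V A : bool :=
  [forall x in V, forall y in V, (x != y) ==> (A x y == 0)].

Definition refine V psi phi : option (seq {set 'I_n}) :=
  if compatible V psi phi then Some (meet psi phi)
  else if compatible V psi (rev phi) then Some (meet psi (rev phi))
  else None.

(* Runs of the procedure on the principal submatrix A[U]; the outcome Some Phi
   means that Phi is returned, None that the run stops with a failure. The
   choices left open by the two subroutines (an order of the components, a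
   straight enumeration) are nondeterministic; each subroutine fails only if it
   has no valid answer. *)
Inductive robinson :
    'M[R]_n -> {set 'I_n} -> seq {set 'I_n} -> option (seq {set 'I_n}) -> Prop :=
| Robinson_no_order A U psi :
    (forall cs, ~ component_order U (support_graph A) psi cs) ->
    robinson A U psi None
| Robinson_order A U psi cs r :
    component_order U (support_graph A) psi cs ->
    robinson_loop A psi cs r ->
    robinson A U psi r
with robinson_loop :
    'M[R]_n -> seq {set 'I_n} -> seq {set 'I_n} ->
    option (seq {set 'I_n}) -> Prop :=
| Loop_nil A psi : robinson_loop A psi [::] (Some [::])
| Loop_fail A psi V cs :
    robinson_component A psi V None -> robinson_loop A psi (V :: cs) None
| Loop_next A psi V cs Phi r :
    robinson_component A psi V (Some Phi) -> robinson_loop A psi cs r ->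
    robinson_loop A psi (V :: cs) (omap (cat Phi) r)
with robinson_component :
    'M[R]_n -> seq {set 'I_n} -> {set 'I_n} ->
    option (seq {set 'I_n}) -> Prop :=
| Component_not_straight A psi V :
    (forall phi, ~ straight_enumeration V (support_graph A) phi) ->
    robinson_component A psi V None
| Component_incompatible A psi V phi :
    straight_enumeration V (support_graph A) phi ->
    refine V (restrict psi V) phi = None ->
    robinson_component A psi V None
| Component_stop A psi V phi Phi :
    straight_enumeration V (support_graph A) phi ->
    refine V (restrict psi V) phi = Some Phi ->
    off_diagonal_zero V (peel V A) ->
    robinson_component A psi V (Some Phi)
| Component_recurse A psi V phi Phi r :
    straight_enumeration V (support_graph A) phi ->
    refine V (restrict psi V) phi = Some Phi ->
    ~~ off_diagonal_zero V (peel V A) ->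
    robinson (peel V A) V Phi r ->
    robinson_component A psi V r.

Definition level_enumerations A (phi : nat -> seq {set 'I_n}) : Prop :=
  forall l, (1 <= l <= max_level [set: 'I_n] A)%N ->
    straight_enumeration [set: 'I_n] (level_graph [set: 'I_n] A l) (phi l).

Lemma mem_levels U A v : reflect (v = 0 \/ exists x y, [/\ x \in U, y \in U & v = A x y])
   (v \in levels U A).
Proof.
rewrite /levels mem_sort mem_undup inE.
apply: (iffP orP) => [[/eqP|/allpairsP[[x y] /= [xU yU ->]]]|[->|[x [y [xU yU ->]]]]].
- by left.
- by right; exists x, y; rewrite -!(mem_enum U).
- by left.
- by right; apply/allpairsP; exists (x,y); rewrite /= !mem_enum.
Qed.

Lemma uniq_levels U A : uniq (levels U A).
Proof. by rewrite sort_uniq undup_uniq. Qed.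

Lemma level_pos V A : (forall x y, 0 <= A x y) -> (1 < size (levels V A))%N ->
  0 < level V A 1.
Proof.
move=> A0 s1.
have ge0 v : v \in levels V A -> 0 <= v by case/mem_levels => [->|[x [y [_ _ ->]]]].
have : level V A 0 < level V A 1.
  rewrite lt_neqAle; apply/andP; split.
    by rewrite /level nth_uniq ?uniq_levels //; apply: ltn_trans s1.
  apply: (sorted_leq_nth le_trans le_refl 0) => //; last exact: ltn_trans s1.
  exact: sort_le_sorted.
by apply: le_lt_trans; apply: ge0; rewrite mem_nth //; apply: ltn_trans s1.
Qed.

Lemma peel_ltn U V A : (forall x y, 0 <= A x y) -> V \subset U ->
  ~~ off_diagonal_zero V (peel V A) ->
  (size (levels V (peel V A)) < size (levels U A))%N.
Proof.
move=> A0 VU; rewrite negb_forall_in => /existsP[x /andP[xV]].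
rewrite negb_forall_in => /existsP[y /andP[yV]].
rewrite negb_imply mxE => /andP[_]; case: ifP => [|_ Axy]; first by rewrite eqxx.
have s1 : (1 < size (levels V A))%N.
  rewrite ltnNge; apply/negP => s1.
  have h0 : 0 \in levels V A by apply/mem_levels; left.
  have h1 : A x y \in levels V A by apply/mem_levels; right; exists x, y.
  case: (levels V A) s1 h0 h1 => [|a [|b l]] //= _; rewrite !inE => /eqP <-.
  by rewrite (negbTE Axy).
have p := level_pos A0 s1.
apply: (@leq_trans (size (levels V A))); last first.
  apply: uniq_leq_size; first exact: uniq_levels.
  move=> v /mem_levels [->|[a [b [aV bV ->]]]]; apply/mem_levels; [by left|right].
  by exists a, b; rewrite !(subsetP VU).
apply: (@uniq_leq_size _ (level V A 1 :: levels V (peel V A))).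
  rewrite /= uniq_levels andbT; apply/negP => /mem_levels [E|[a [b [_ _]]]].
    by rewrite E ltxx in p.
  rewrite mxE; case: ifP => [_ E|+ E]; first by rewrite E ltxx in p.
  by rewrite E eqxx.
move=> v; rewrite inE => /orP[/eqP ->|]; first exact: mem_nth.
case/mem_levels => [->|[a [b [aV bV ->]]]]; apply/mem_levels; first by left.
by rewrite mxE; case: ifP => _; [left|right; exists a, b].
Qed.

Theorem robinson_total A U psi : (forall x y, 0 <= A x y) ->
  exists r, robinson A U psi r.
Proof.
move: {2}(size (levels U A)).+1 (ltnSn (size (levels U A))) => m.
elim: m A U psi => // m IH A U psi; rewrite ltnS => sm A0.
case: (classic (exists cs, component_order U (support_graph A) psi cs)); last first.
  by move=> h; exists None; apply: Robinson_no_order => cs hcs; apply: h; exists cs.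
case=> cs hcs.
suff [r hr] : exists r, robinson_loop A psi cs r by exists r; exact: Robinson_order hr.
have sub : forall V, V \in cs -> V \subset U.
  case: hcs => _ e _ V Vc; have : V \in [set V in cs] by rewrite inE.
  by rewrite e => /imsetP[x _ ->]; apply/subsetP => y; rewrite inE => /andP[].
elim: cs sub {hcs} => [|V cs IHcs] sub; first by exists (Some [::]); constructor.
have [r' hr'] : exists r, robinson_loop A psi cs r.
  by apply: IHcs => W Wc; apply: sub; rewrite inE Wc orbT.
suff [[Phi|] h] : exists r, robinson_component A psi V r.
- by exists (omap (cat Phi) r'); constructor.
- by exists None; constructor.
case: (classic (exists phi, straight_enumeration V (support_graph A) phi)); last first.
  by move=> h; exists None; apply: Component_not_straight => p hp; apply: h; exists p.
case=> phi hphi; case E : (refine V (restrict psi V) phi) => [Phi|]; last first.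
  by exists None; apply: Component_incompatible E.
case O : (off_diagonal_zero V (peel V A)).
  by exists (Some Phi); apply: Component_stop E O.
move/negbT: O => O; have [] := IH (peel V A) V Phi.
- apply: leq_trans sm; apply: peel_ltn => //; apply: sub; exact: mem_head.
- by move=> x y; rewrite mxE; case: ifP.
move=> r hr; exists r; exact: (Component_recurse hphi E O hr).
Qed.

End Robinson.

(* Main.v *)
Require Import Defs.
From HB Require Import structures.
From mathcomp Require Import all_boot all_order all_algebra zify.
Set Implicit Arguments.
Unset Strict Implicit.
Unset Printing Implicit Defensive.
Import Order.TTheory GRing.Theory Num.Theory.

(** Up to reversal a connected graph has only one straight enumeration: the
middle vertex of an induced path on three vertices must lie between its ends,
and in a connected graph these constraints orient all edges coherently.

Success: the output refines psi and every straight enumeration met on the way.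
On a component V, the level graphs up to the smallest nonzero entry of A[V] are
all the support graph, and those above are level graphs of A'[V], so one recurses;
straight enumerations of the components are concatenated.

Failure: from compatible straight enumerations of all level graphs, the lowest
one orders the components consistently with psi, and its restriction to V is, up to
reversal, the enumeration chosen by the procedure. If it is the reversal, then
psi is constant on V and the whole family can be reversed on V. Hence
restricting to V gives such a family for the recursive call. *)

(** * Weak linear orders *)

Section WeakLinearOrderTheory.
Variable T : finType.
Implicit Types (U V W B C : {set T}) (psi phi : seq {set T}) (x y z : T).

Lemma weak_linear_orderP U psi :
  reflect [/\ uniq psi, set0 \notin psi,
              forall x, (x \in U) = has (fun B : {set T} => x \in B) psi
            & forall B C x, B \in psi -> C \in psi -> x \in B -> x \in C -> B = C]
          (weak_linear_order U psi).
Proof.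
apply: (iffP andP) => [[u /and3P[/eqP cov /trivIsetP tI n0]]|[u n0 mU cl]].
  split=> // [|x|B C x BP CP xB xC]; first by rewrite inE in n0.
    rewrite -cov; apply/bigcupP/hasP => [[B]|[B]]; rewrite ?inE; first by exists B.
    by move=> ? ?; exists B; rewrite ?inE.
  apply/eqP/negPn/negP => /tI; rewrite !inE BP CP => /(_ isT isT).
  by move/disjointFr/(_ xB); rewrite xC.
split=> //; apply/and3P; split; last by rewrite inE.
  apply/eqP/setP => x; rewrite mU; apply/bigcupP/hasP => [[B]|[B]];
    rewrite ?inE; first by exists B.
  by move=> ? ?; exists B; rewrite ?inE.
apply/trivIsetP => B C; rewrite !inE => BP CP; apply: contraR.
by case/pred0Pn=> x /andP[/= xB xC]; rewrite (cl B C x).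
Qed.

Lemma mem_nth_rank U psi x :
  weak_linear_order U psi -> x \in U -> x \in nth set0 psi (rank psi x).
Proof.
move=> w xU; apply: (@nth_find _ set0 (fun B : {set T} => x \in B)).
by rewrite has_find; apply: rank_ltn w xU.
Qed.

Lemma rank_eq U psi x i :
  weak_linear_order U psi -> x \in nth set0 psi i -> rank psi x = i.
Proof.
move=> w xi; have szi : i < size psi.
  by rewrite ltnNge; apply/negP => /(nth_default set0) E; rewrite E inE in xi.
have [u _ mU cl] := weak_linear_orderP _ _ w.
have xU : x \in U by rewrite mU; apply/hasP; exists (nth set0 psi i);
  rewrite ?mem_nth.
have lt := rank_ltn w xU.
apply/eqP; rewrite -(nth_uniq set0 lt szi u); apply/eqP.
by apply: (cl _ _ x) => //; rewrite ?mem_nth //; apply: mem_nth_rank w xU.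
Qed.

Lemma class_sub U psi B x :
  weak_linear_order U psi -> B \in psi -> x \in B -> x \in U.
Proof. by case/weak_linear_orderP=> _ _ mU _ BP xB; rewrite mU; apply/hasP;
  exists B. Qed.

Lemma nth_class_sub U psi i x :
  weak_linear_order U psi -> x \in nth set0 psi i -> x \in U.
Proof.
move=> w xi; apply: (class_sub w _ xi); apply: mem_nth; rewrite ltnNge.
by apply/negP => /(nth_default set0) E; rewrite E inE in xi.
Qed.

Lemma weak_linear_order_rev U psi :
  weak_linear_order U psi -> weak_linear_order U (rev psi).
Proof.
case/weak_linear_orderP=> u n0 mU cl; apply/weak_linear_orderP; split.
- by rewrite rev_uniq.
- by rewrite mem_rev.
- by move=> x; rewrite mU has_rev.
- by move=> B C x; rewrite !mem_rev; apply: cl.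
Qed.

Lemma rank_rev U psi x : weak_linear_order U psi -> x \in U ->
  rank (rev psi) x = size psi - (rank psi x).+1.
Proof.
move=> w xU; have lt := rank_ltn w xU.
apply: (rank_eq (weak_linear_order_rev w)); rewrite nth_rev; last by lia.
by have -> : size psi - (size psi - (rank psi x).+1).+1 = rank psi x;
  [lia | exact: mem_nth_rank w xU].
Qed.

Lemma wlt_rev U psi x y : weak_linear_order U psi -> x \in U -> y \in U ->
  wlt (rev psi) x y = wlt psi y x.
Proof.
move=> w xU yU; rewrite /wlt !(rank_rev w) //.
by have := rank_ltn w xU; have := rank_ltn w yU; lia.
Qed.

Lemma weak_linear_order_restrict U V psi : V \subset U ->
  weak_linear_order U psi -> weak_linear_order V (restrict psi V).
Proof.
move=> /subsetP VU /weak_linear_orderP[u n0 mU cl]; apply/weak_linear_orderP; split.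
- rewrite map_inj_in_uniq ?filter_uniq // => B C.
  rewrite !mem_filter => /andP[/set0Pn[x xBV] BP] /andP[_ CP] E.
  have := xBV; rewrite E => /setIP[xC _]; case/setIP: xBV => xB _.
  exact: (cl _ _ x).
- by apply/mapP => -[B]; rewrite mem_filter => /andP[n _] E; rewrite -E eqxx in n.
- move=> x; apply/idP/hasP => [xV|[C /mapP[B _ ->] /setIP[]//]].
  have := VU _ xV; rewrite mU => /hasP[B BP xB].
  have xBV : x \in B :&: V by rewrite inE xB.
  by exists (B :&: V) => //; apply: map_f; rewrite mem_filter BP andbT;
    apply/set0Pn; exists x.
- move=> B C x /mapP[B']; rewrite mem_filter => /andP[_ BP] -> /mapP[C'].
  rewrite mem_filter => /andP[_ CP] -> /setIP[xB _] /setIP[xC _].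
  by rewrite (cl B' C' x).
Qed.

(** Only classes disjoint from [V] are dropped, and those of [x] and [y] survive, so the filter
    keeps their relative position. *)
Lemma wlt_restrict V psi x y : x \in V -> y \in V ->
  wlt (restrict psi V) x y = wlt psi x y.
Proof.
move=> xV yV; rewrite /wlt /rank /restrict !find_map.
have E z : z \in V -> preim (fun B => B :&: V) (fun B :
  {set T} => z \in B) =1 (fun B : {set T} => z \in B).
  by move=> zV B; rewrite /= inE zV andbT.
rewrite !(eq_find (E _ _)) //; apply: ltn_find_filter => B zB; apply/set0Pn.
  by exists x; rewrite inE zB.
by exists y; rewrite inE zB.
Qed.

Lemma rank_cat psi phi x : rank (psi ++ phi) x =
  if rank psi x < size psi then rank psi x else size psi + rank phi x.
Proof. by rewrite /rank find_cat has_find. Qed.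

Lemma rank_notin U psi x : weak_linear_order U psi -> x \notin U ->
  rank psi x = size psi.
Proof.
by case/weak_linear_orderP=> _ _ mU _; rewrite mU => h; apply: hasNfind.
Qed.

Lemma weak_linear_order_cat U V psi phi : [disjoint U & V] ->
  weak_linear_order U psi -> weak_linear_order V phi ->
  weak_linear_order (U :|: V) (psi ++ phi).
Proof.
move=> dUV w1 w2; have disj x B C :
  B \in psi -> C \in phi -> x \in B -> x \in C -> False.
  move=> BP CP /(class_sub w1 BP) xU /(class_sub w2 CP) xV.
  by rewrite (disjointFr dUV xU) in xV.
move/weak_linear_orderP: w1 => [u1 n1 m1 c1].
move/weak_linear_orderP: w2 => [u2 n2 m2 c2].
apply/weak_linear_orderP; split.
- rewrite cat_uniq u1 u2 andbT /=; apply/hasPn => B B2; apply/negP => /= B1.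
  have [B0|[x xB]] := set_0Vmem B; first by rewrite B0 (negbTE n1) in B1.
  exact: (disj x B B).
- by rewrite mem_cat negb_or n1.
- by move=> x; rewrite inE m1 m2 has_cat.
- move=> B C x; rewrite !mem_cat => /orP[BP|BP] /orP[CP|CP] xB xC.
  + exact: c1 xB xC.
  + by case: (disj x B C).
  + by case: (disj x C B).
  + exact: c2 xB xC.
Qed.

(** The finer order comes first: [psi] may break ties of [phi] but keeps its strict comparisons. *)
Definition refines U psi phi := {in U &, forall x y, wlt phi x y -> wlt psi x y}.

Lemma refines_trans U psi1 psi2 psi3 :
  refines U psi1 psi2 -> refines U psi2 psi3 -> refines U psi1 psi3.
Proof. by move=> r12 r23 x y xU yU /(r23 _ _ xU yU); apply: r12. Qed.

Lemma refines_compatible U psi phi : refines U psi phi -> compatible U psi phi.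
Proof.
move=> r; apply/forall_inP => x xU; apply/forall_inP => y yU.
by apply/negP => /andP[xy] /(r _ _ yU xU); move: xy; rewrite /wlt; lia.
Qed.

Lemma compatibleP U psi phi :
  reflect {in U &, forall x y, wlt psi x y -> wle phi x y} (compatible U psi phi).
Proof.
apply: (iffP forall_inP) => [c x y xU yU xy|c x xU].
  have /forall_inP/(_ _ yU) := c _ xU.
  by rewrite xy /wle leqNgt.
apply/forall_inP => y yU; apply/negP => /andP[/(c _ _ xU yU)].
by rewrite /wle leqNgt => /negP.
Qed.

Lemma compatible_sym U psi phi : compatible U psi phi -> compatible U phi psi.
Proof.
move=> /compatibleP c; apply/compatibleP => x y xU yU.
rewrite /wle leqNgt; apply: contraL => /(c _ _ yU xU).
by rewrite /wle /wlt; lia.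
Qed.

Lemma refines_meetl U psi phi :
  weak_linear_order U psi -> weak_linear_order U phi ->
    refines U (meet psi phi) psi.
Proof.
by move=> w1 w2 x y xU yU xy;
  rewrite wlt_meet_lex ?xy // ?(rank_ltn w1) ?(rank_ltn w2).
Qed.

(** The meet is listed lexicographically with [psi] leading, so it refines [psi] outright, while
    refining [phi] relies on compatibility. *)
Lemma refines_meetr U psi phi :
  weak_linear_order U psi -> weak_linear_order U phi -> compatible U psi phi ->
  refines U (meet psi phi) phi.
Proof.
move=> w1 w2 c x y xU yU xy; rewrite (meet_wlt w1 w2 c xU yU) xy orbT andbT.
have /compatibleP/(_ x y xU yU xy) -> := compatible_sym c.
by move: xy; rewrite /wlt /wle => /ltnW.
Qed.

(* A linear extension of psi, listed as singletons; ties are broken by the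
   enumeration of T. *)
Definition linear_extension U psi : seq {set T} :=
  meet psi [seq [set x] | x <- enum U].

Lemma weak_linear_order_singletons U :
  weak_linear_order U [seq [set x] | x <- enum U].
Proof.
apply/weak_linear_orderP; split.
- by rewrite map_inj_uniq ?enum_uniq //; apply: set1_inj.
- by apply/mapP => -[x _ /setP/(_ x)]; rewrite !inE eqxx.
- move=> x; apply/idP/hasP => [xU|[B /mapP[y yU ->]]].
    by exists [set x]; rewrite ?set11 //; apply: map_f; rewrite mem_enum.
  by rewrite inE => /eqP ->; rewrite mem_enum in yU.
- by move=> B C x /mapP[y _ ->] /mapP[z _ ->]; rewrite !inE => /eqP -> /eqP ->.
Qed.

Lemma linear_extension_wlo U psi :
  weak_linear_order U psi -> weak_linear_order U (linear_extension U psi).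
Proof. by move=> w; apply: meet_wlo => //; apply: weak_linear_order_singletons. Qed.

Lemma linear_extension_weq U psi x y : weak_linear_order U psi ->
  x \in U -> y \in U -> weq (linear_extension U psi) x y = (x == y).
Proof.
move=> w xU yU; have w1 := weak_linear_order_singletons U.
rewrite (meet_weq w w1) //; apply/andP/eqP => [[_ /eqP E]|->];
  last by rewrite /weq !eqxx.
have := mem_nth_rank w1 xU; have := mem_nth_rank w1 yU; rewrite E.
have lt := rank_ltn w1 yU; rewrite size_map in lt.
rewrite (nth_map x) // !inE => /eqP Ey /eqP Ex; exact: etrans Ex (esym Ey).
Qed.

End WeakLinearOrderTheory.

(** * Straight enumerations *)

Section StraightEnumerationTheory.
Variables (T : finType) (U : {set T}).
Implicit Types (e : rel T) (phi : seq {set T}) (f g : T -> nat).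

(** Straightness read off numerical positions: vertices tie exactly when they are twins, and the
    ends of an edge are adjacent to every vertex strictly between them (the umbrella property). In
    this form, restriction and reversal only compare inequalities. *)
Definition straight_rank e f : Prop :=
  {in U &, forall x y, (f x == f y) = (closed_nbh U e x == closed_nbh U e y)} /\
  {in U & &, forall x y z, f x < f y -> f y < f z -> e x z -> e x y && e y z}.

Lemma eq_straight_rank e e' f : {in U &, forall x y, e x y = e' x y} ->
  straight_rank e f -> straight_rank e' f.
Proof.
move=> ee' [s1 s2]; split=> [x y xU yU|x y z xU yU zU].
  have N z : z \in U -> closed_nbh U e' z = closed_nbh U e z.
    move=> zU; apply/setP => t; rewrite !inE; case tU: (t \in U) => //=.
    by rewrite ee'.
  by rewrite !N // s1.
by rewrite -!ee' //; apply: s2.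
Qed.

Lemma twin_adjacent e x y z : x \in U -> z \in U ->
  closed_nbh U e x = closed_nbh U e y -> e x z -> z != y -> e y z.
Proof.
move=> xU zU /setP/(_ z); rewrite !inE zU /= => + exz zy.
by rewrite exz orbT (negbTE zy).
Qed.

(** Vertices of one block are twins, so adjacency of two distinct blocks amounts to adjacency of any
    representatives; consecutiveness of blocks then becomes the umbrella property of vertices. *)
Lemma straight_enumerationP e phi : symmetric e ->
  straight_enumeration U e phi <->
  weak_linear_order U phi /\ straight_rank e (rank phi).
Proof.
move=> es; split.
  case=> u sb cons.
  have w : weak_linear_order U phi.
    rewrite /weak_linear_order u sb;
      apply: equivalence_partitionP => x y z _ _ _ /=.
    by split=> [|/eqP ->]; rewrite ?eqxx.
  have tw x y : x \in U -> y \in U ->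
    (rank phi x == rank phi y) = (closed_nbh U e x == closed_nbh U e y).
    move=> xU yU; have lt := rank_ltn w xU.
    have : nth set0 phi (rank phi x) \in blocks U e by rewrite -sb inE mem_nth.
    case/imsetP=> x0 x0U E.
    have := mem_nth_rank w xU; rewrite E inE xU /= => /eqP Ex.
    apply/eqP/eqP => [R|N].
      by have := mem_nth_rank w yU; rewrite -R E inE yU /= -Ex => /eqP.
    by apply/esym/(rank_eq w); rewrite E inE yU /= -N Ex.
  split=> //; split=> // x y z xU yU zU.
  move=> xy yz exz; have [[ltx lty] ltz] :=
    (rank_ltn w xU, rank_ltn w yU, rank_ltn w zU).
  (* The edge found between two blocks is moved to the given vertices one end at a time, replacing
     each end with a twin. *)
  have tr a b : a \in U -> b \in U -> rank phi a != rank phi b ->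
      adjacent_or_eq e (nth set0 phi (rank phi a)) (nth set0 phi (rank phi b))
        -> e a b.
    move=> aU bU ab /orP[|/existsP[c /andP[ca /existsP[d /andP[db ecd]]]]].
      by rewrite nth_uniq ?(rank_ltn w) // (negbTE ab).
    have [rc rd] := (rank_eq w ca, rank_eq w db).
    have [cU dU] : c \in U /\ d \in U by split;
      [apply: nth_class_sub w ca|apply: nth_class_sub w db].
    have Nca : closed_nbh U e c = closed_nbh U e a by apply/eqP; rewrite -tw // rc.
    have Ndb : closed_nbh U e d = closed_nbh U e b by apply/eqP; rewrite -tw // rd.
    have ead : e a d.
      by apply: (twin_adjacent cU dU Nca ecd); apply: contraNneq ab => <-;
        rewrite rd.
    rewrite es; apply: (twin_adjacent dU aU Ndb); first by rewrite es.
    by apply: contraNneq ab => ->.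
  have adj a b : a \in U -> b \in U -> e a b ->
    adjacent_or_eq e (nth set0 phi (rank phi a)) (nth set0 phi (rank phi b)).
    move=> aU bU eab; apply/orP; right; apply/existsP; exists a.
    rewrite (mem_nth_rank w aU); apply/existsP; exists b.
    by rewrite (mem_nth_rank w bU).
  have adj0 B : adjacent_or_eq e B B by rewrite /adjacent_or_eq eqxx.
  have xyz : rank phi x < rank phi y < rank phi z by rewrite xy.
  apply/andP; split.
    apply: tr => //; first by rewrite neq_ltn xy.
    by apply: (cons _ _ _ _ _ xyz); rewrite ?mem_nth //; apply: adj.
  rewrite es; apply: tr => //; first by rewrite neq_ltn yz orbT.
  by apply: (cons _ _ _ _ _ xyz); rewrite ?mem_nth //; apply: adj; rewrite 1?es.
case=> w [tw um]; have [u n0 mU cl] := weak_linear_orderP _ _ w.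
have blk x : x \in U ->
  nth set0 phi (rank phi x) = [set y in U | closed_nbh U e x == closed_nbh U e y].
  move=> xU; apply/setP => y; rewrite inE; apply/idP/andP => [yx|[yU]].
    have yU := nth_class_sub w yx.
    by rewrite -tw // (rank_eq w yx).
  by rewrite -tw // => /eqP ->; apply: mem_nth_rank w yU.
have rep B : B \in phi -> exists2 x, x \in U & B = nth set0 phi (rank phi x).
  move=> BP; have [B0|[x xB]] := set_0Vmem B; first by rewrite B0 (negbTE n0) in BP.
  have xU := class_sub w BP xB; exists x => //.
  by apply: (cl _ _ x) => //; rewrite ?mem_nth ?(rank_ltn w) ?(mem_nth_rank w).
split=> //.
  apply/setP => B; rewrite inE; apply/idP/imsetP => [/rep[x xU ->]|[x xU ->]].
    by exists x => //; apply: blk.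
  by rewrite /= -blk // mem_nth ?(rank_ltn w).
move=> B i j k BP /andP[ij jk] kP ai ak.
have [b bU Bb] := rep _ BP.
have [jb|jb] := eqVneq j (rank phi b).
  by rewrite jb Bb /adjacent_or_eq eqxx.
have jP : j < size phi by lia.
have [d dU Bd] := rep _ (mem_nth set0 jP).
have dj : rank phi d = j.
  by apply/eqP; rewrite -(nth_uniq set0 (rank_ltn w dU) jP u) -Bd.
have ex m : adjacent_or_eq e B (nth set0 phi m) -> m != rank phi b ->
  m < size phi ->
    exists a c, [/\ a \in B, a \in U, c \in U,
      rank phi a = rank phi b & rank phi c = m /\ e a c].
  case/orP=> [Em|/existsP[a /andP[aB /existsP[c /andP[cm eac]]]]] mb mP.
    by move: Em; rewrite Bb nth_uniq ?(rank_ltn w) // eq_sym (negbTE mb).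
  exists a, c; split=> //; first exact: class_sub w BP aB.
  - exact: nth_class_sub w cm.
  - by apply: (rank_eq w); rewrite -Bb.
  - by rewrite (rank_eq w cm).
(* Block [j] lies on one side of the block of [b], so an edge from that block to block [i] or to
   block [k] passes over it, and the umbrella property applies to this edge. *)
apply/orP; right; have [jlt|jgt] : j < rank phi b \/ rank phi b < j by lia.
  have [||a [c [aB aU cU ra [rc eac]]]] := ex _ ai; try by lia.
  apply/existsP; exists a; rewrite aB; apply/existsP; exists d.
  rewrite Bd (mem_nth_rank w dU) /= es.
  have /andP[] // : e c d && e d a.
  by apply: um; rewrite ?ra ?rc ?dj // es.
have [||a [c [aB aU cU ra [rc eac]]]] := ex _ ak; try by lia.
apply/existsP; exists a; rewrite aB; apply/existsP; exists d.
rewrite Bd (mem_nth_rank w dU) /=.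
have /andP[] // : e a d && e d c.
by apply: um; rewrite ?ra ?rc ?dj // es.
Qed.

End StraightEnumerationTheory.

(** * Uniqueness up to reversal *)

Section Uniqueness.
Variables (T : finType) (U : {set T}) (e : rel T).
Hypothesis e_sym : symmetric e.

(** If an end of the path lay strictly between the other two vertices, the umbrella property would
    join the two ends. Ties are excluded, as no two vertices of an induced path are twins. So [b]
    lies between [a] and [c]. *)
Lemma straight_rank_induced_path f a b c : straight_rank U e f ->
  a \in U -> b \in U -> c \in U -> e a b -> e b c -> ~~ e a c -> a != c ->
  (f a < f b) = (f a < f c) /\ (f b < f c) = (f a < f c).
Proof.
move=> [tw um] aU bU cU ab bc ac a_c.
have ab' : f a != f b.
  apply: contraNneq ac => /eqP; rewrite tw // => /eqP N.
  by apply: (twin_adjacent bU cU (esym N) bc); rewrite eq_sym.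
have bc' : f b != f c.
  apply: contraNneq ac => /eqP; rewrite tw // => /eqP N.
  by rewrite e_sym; apply: (twin_adjacent bU aU N) => //; rewrite e_sym.
have ac' : f a != f c.
  apply: contraNneq ac => /eqP; rewrite tw // => /eqP/setP/(_ c).
  by rewrite !inE cU eqxx /= eq_sym (negbTE a_c).
have [ba cb] : e b a /\ e c b by rewrite ![e _ b]e_sym e_sym ab.
have h1 : f b < f a -> f a < f c -> False.
  by move=> h h'; have /andP[] := um _ _ _ bU aU cU h h' bc; rewrite (negbTE ac).
have h2 : f c < f a -> f a < f b -> False.
  by move=> h h'; have /andP[] := um _ _ _ cU aU bU h h' cb;
    rewrite e_sym (negbTE ac).
have h3 : f a < f c -> f c < f b -> False.
  by move=> h h'; have /andP[] := um _ _ _ aU cU bU h h' ab; rewrite (negbTE ac).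
have h4 : f b < f c -> f c < f a -> False.
  by move=> h h'; have /andP[_] := um _ _ _ bU cU aU h h' ba;
    rewrite e_sym (negbTE ac).
move: ab' bc' ac' h1 h2 h3 h4.
by case: (ltngtP (f a) (f b)); case: (ltngtP (f b) (f c));
  case: (ltngtP (f a) (f c)) => //=;
  intuition lia.
Qed.

(** Different positions mean different closed neighborhoods. As [a] and [b] are adjacent, both
    belong to both neighborhoods, so the distinguishing vertex is a third one. *)
Lemma straight_rank_distinguish f a b : straight_rank U e f ->
  a \in U -> b \in U -> e a b -> f a != f b ->
  exists z, [/\ z \in U, z != a, z != b & e a z && ~~ e b z || e b z && ~~ e a z].
Proof.
move=> [tw _] aU bU ab; rewrite tw // => /eqP N.
have [z] : exists z, (z \in closed_nbh U e a) != (z \in closed_nbh U e b).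
  apply/existsP; apply: contra_notT N; rewrite negb_exists => /forallP h.
  by apply/setP => z; apply/eqP; move: (h z); rewrite negbK.
rewrite !inE; case zU: (z \in U) => //=; exists z; split=> //.
- by apply: contraNneq p => ->; rewrite eqxx e_sym ab orbT.
- by apply: contraNneq p => ->; rewrite eqxx ab orbT.
have za : z != a by apply: contraNneq p => ->; rewrite eqxx e_sym ab orbT.
have zb : z != b by apply: contraNneq p => ->; rewrite eqxx ab orbT.
by move: p; rewrite (negbTE za) (negbTE zb) /=; case: (e a z); case: (e b z).
Qed.

Section TwoRanks.
Variables f g : T -> nat.
Hypotheses (f_straight : straight_rank U e f) (g_straight : straight_rank U e g).

Let um x y z : x \in U -> y \in U -> z \in U -> f x < f y -> f y < f z ->
  e x z -> e x y && e y z.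
Proof. by case: f_straight => _; apply. Qed.

Let eq_fg x y : x \in U -> y \in U -> (f x == f y) = (g x == g y).
Proof. by move=> xU yU; case: f_straight => -> // _; case: g_straight => ->. Qed.

(* The triangle is oriented through a vertex distinguishing two of its corners,
   which lies on induced paths with them. *)
Lemma straight_rank_triangle a b c : a \in U -> b \in U -> c \in U ->
  f a < f b -> f b < f c -> e a b -> e b c -> e a c ->
  (g a < g b) = (g a < g c) /\ (g b < g c) = (g a < g c).
Proof.
move=> aU bU cU ltab ltbc ab bc ac.
have [nab nbc] : f a != f b /\ f b != f c by rewrite !neq_ltn ltab ltbc.
split.
  have [z [zU za zb]] := straight_rank_distinguish f_straight aU bU ab nab.
  case/orP=> /andP[].
    (* Here [z] comes before [b] and is not adjacent to [c], so z-a-b and z-a-c are induced paths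
       sharing the edge za, and [g] orients ab and ac alike. *)
    rewrite ![e _ z]e_sym => eza ezb.
    have pf : f z < f b.
      by have [_ <-] := straight_rank_induced_path f_straight zU aU bU eza ab
        ezb zb.
    have ezc : ~~ e z c.
      by apply: contraNN ezb => ezc; have /andP[] := um zU bU cU pf ltbc ezc.
    have zc : z != c by apply: contraNneq ezb => ->; rewrite e_sym.
    have [<- ->] := straight_rank_induced_path g_straight zU aU bU eza ab ezb zb.
    by have [-> ->] := straight_rank_induced_path g_straight zU aU cU eza ac ezc zc.
  move=> ebz eaz.
  (* Here [z] lies beyond [c], so a-b-z and a-c-z are induced paths with the same ends. *)
  have az : a != z by rewrite eq_sym.
  have [pab pbz] := straight_rank_induced_path f_straight aU bU zU ab ebz eaz az.
  have ltaz : f a < f z by rewrite -pab.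
  have ltbz : f b < f z by rewrite pbz.
  have ltcz : f c < f z.
    case: (ltngtP (f c) (f z)) => // [ltzc|/eqP E].
      by have /andP[] := um aU zU cU ltaz ltzc ac; rewrite (negbTE eaz).
    case: f_straight => tw _; move: E; rewrite tw // => /eqP N.
    move: (twin_adjacent cU aU N); rewrite e_sym ac => /(_ isT az).
    by rewrite e_sym (negbTE eaz).
  have /andP[_ ecz] := um bU cU zU ltbc ltcz ebz.
  have [-> _] := straight_rank_induced_path g_straight aU bU zU ab ebz eaz az.
  by have [-> _] := straight_rank_induced_path g_straight aU cU zU ac ecz eaz az.
(* The edge bc is the mirror image, with [z] now distinguishing [b] from [c]. *)
have [z [zU zb zc]] := straight_rank_distinguish f_straight bU cU bc nbc.
have [bz cz] : b != z /\ c != z by rewrite ![_ == z]eq_sym.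
case/orP=> /andP[]; last first.
  move=> ecz ebz.
  have [pbc pcz] := straight_rank_induced_path f_straight bU cU zU bc ecz ebz bz.
  have ltbz : f b < f z by rewrite -pbc.
  have eaz : ~~ e a z.
    by apply: contraNN ebz => eaz; have /andP[] := um aU bU zU ltab ltbz eaz.
  have az : a != z by apply: contraNneq ebz => <-; rewrite e_sym.
  have [-> <-] := straight_rank_induced_path g_straight bU cU zU bc ecz ebz bz.
  by have [-> ->] := straight_rank_induced_path g_straight aU cU zU ac ecz eaz az.
rewrite [e b z]e_sym [e c z]e_sym => ezb ezc.
have [pzb pbc] := straight_rank_induced_path f_straight zU bU cU ezb bc ezc zc.
have ltzc : f z < f c by rewrite -pbc.
have ltza : f z < f a.
  case: (ltngtP (f z) (f a)) => // [ltaz|/eqP E].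
    by have /andP[_] := um aU zU cU ltaz ltzc ac; rewrite (negbTE ezc).
  case: f_straight => tw _; move: E; rewrite tw // => /eqP N.
  by move: (twin_adjacent aU cU (esym N) ac cz); rewrite (negbTE ezc).
have ltzb : f z < f b by rewrite pzb.
have /andP[eza _] := um zU aU bU ltza ltab ezb.
have [_ ->] := straight_rank_induced_path g_straight zU bU cU ezb bc ezc zc.
by have [_ ->] := straight_rank_induced_path g_straight zU aU cU eza ac ezc zc.
Qed.

(** If ac is an edge this is the triangle case; otherwise a-b-c is an induced path. *)
Lemma straight_rank_orient a b c : a \in U -> b \in U -> c \in U ->
  f a < f b -> f b < f c -> e a b -> e b c ->
  (g a < g b) = (g b < g c) /\ (e a c -> (g a < g c) = (g a < g b)).
Proof.
move=> aU bU cU ltab ltbc ab bc.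
have [ac|ac] := boolP (e a c);
  first by have [-> ->] := straight_rank_triangle aU bU cU ltab ltbc ab bc ac.
have a_c : a != c by apply: contraTneq (ltn_trans ltab ltbc) => ->; rewrite ltnn.
have [-> ->] := straight_rank_induced_path g_straight aU bU cU ab bc ac a_c.
by split=> // eac; rewrite eac in ac.
Qed.

Definition agree x y := (f x < f y) == (g x < g y).

(** If [b] and [c] lie at different positions on the same side of [a], the umbrella property
    supplies the edge bc; if on opposite sides, [a] lies between them. Either way
    [straight_rank_orient] applies to the three vertices. *)
Lemma straight_rank_agree a b c : a \in U -> b \in U -> c \in U ->
  e a b -> e a c -> f a != f b -> f a != f c -> agree a b = agree a c.
Proof.
wlog bc : b c / f b <= f c => [hw aU bU cU ab ac nab nac|].
  by case: (leqP (f b) (f c)) => [|/ltnW] h; [|symmetry]; apply: hw.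
move=> aU bU cU ab ac nab nac; rewrite /agree.
have := eq_fg aU bU; have := eq_fg aU cU; have := eq_fg bU cU.
have ba : e b a by rewrite e_sym.
have ca : e c a by rewrite e_sym.
have [E|ltbc] := eqVneq (f b) (f c); first by lia.
have {}ltbc : f b < f c by lia.
have [ltab|leba] := ltnP (f a) (f b).
  have /andP[_ ebc] := um aU bU cU ltab ltbc ac.
  by have [_ /(_ ac)] := straight_rank_orient aU bU cU ltab ltbc ab ebc; lia.
have ltba : f b < f a by lia.
have [ltac|leca] := ltnP (f a) (f c).
  by have [] := straight_rank_orient bU aU cU ltba ltac ba ac; lia.
have ltca : f c < f a by lia.
have /andP[ebc _] := um bU cU aU ltbc ltca ba.
by have [+ /(_ ba)] := straight_rank_orient bU cU aU ltbc ltca ebc ca; lia.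
Qed.

End TwoRanks.

(** Connectedness as an induction principle: a property carried along edges is transported without
    mentioning paths. *)
Definition connected_on : Prop := forall P : pred T,
  {in U &, forall x y, e x y -> P x -> P y} -> {in U &, forall x y, P x -> P y}.

Hypothesis U_conn : connected_on.

(** Induction on the gap in [f]: unless xy is an edge, [x] has a neighbour [z] strictly between [x]
    and [y], and transitivity combines xz with zy. *)
Lemma straight_rank_lift f (r : rel T) : straight_rank U e f -> transitive r ->
  {in U &, forall x y, e x y -> f x < f y -> r x y} ->
  {in U &, forall x y, f x < f y -> r x y}.
Proof.
move=> [tw um] rt er x y; move: {2}(f y - f x).+1 (ltnSn (f y - f x)) => m.
elim: m x y => // m IH x y mxy xU yU xy.
have [exy|nexy] := boolP (e x y); first exact: er.
(* Otherwise the vertices at positions up to that of [x] would be closed under adjacency: an edge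
   leaving them starts at a twin of [x] or passes over [x], and in both cases gives [x] a forward
   neighbour. *)
have [z /and3P[zU xz exz]] : exists z, [&& z \in U, f x < f z & e x z].
  apply/existsP; apply: contraTT xy; rewrite negb_exists => /forallP h.
  rewrite -leqNgt; apply: (U_conn (P :=
    fun v => f v <= f x) _ xU yU) => // a b aU bU eab ax.
  rewrite leqNgt; apply/negP => xb; have := h b; rewrite bU xb /=; apply/negP;
    rewrite negbK.
  have [E|lt] := eqVneq (f a) (f x).
    move/eqP: E; rewrite tw // => /eqP N.
    by apply: (twin_adjacent aU bU N eab); apply: contraTneq xb => ->; rewrite ltnn.
  have {}lt : f a < f x by rewrite ltn_neqAle lt.
  by have /andP[_] := um a x b aU xU bU lt xb eab.
(* If [z] were past [y], the umbrella property would make xy an edge; if it tied with [y], being a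
   twin of [y] would. *)
have zy : f z < f y.
  case: (ltngtP (f z) (f y)) => // [yz|/eqP E].
    by have /andP[] := um _ _ _ xU yU zU xy yz exz; rewrite (negbTE nexy).
  move: E; rewrite tw // => /eqP N; move: nexy; rewrite e_sym.
  rewrite (twin_adjacent zU xU N) //; first by rewrite e_sym.
  by apply: contraTneq xy => ->; rewrite ltnn.
apply: (rt z); first exact: er.
by apply: IH => //; lia.
Qed.

(** Agreement of [f] and [g] is constant on the edges leaving the block of a vertex and passes along
    edges, hence is constant by connectedness; it is then lifted from edges to all pairs. *)
Lemma straight_rank_unique f g : straight_rank U e f -> straight_rank U e g ->
  {in U &, forall x y, (f x < f y) = (g x < g y)} \/
  {in U &, forall x y, (f x < f y) = (g y < g x)}.
Proof.
move=> sf sg; have [U0|[x0 x0U]] := set_0Vmem U; first by left=> x y;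
  rewrite U0 inE.
have eq_fg x y : x \in U -> y \in U -> (f x == f y) = (g x == g y).
  by move=> xU yU; case: (sf) => -> // _; case: (sg) => ->.
(* [true] records that orientations are kept, [false] that they are reversed; a vertex with no edge
   leaving its block satisfies both. *)
pose pos (b : bool) x :=
  [forall y in U, (e x y && (f x != f y)) ==> (agree f g x y == b)].
have posP b x y : pos b x -> y \in U -> e x y -> f x != f y -> agree f g x y == b.
  move=> /forall_inP h yU exy nxy.
  by apply: (implyP (h y yU)); rewrite exy nxy.
have loc x : x \in U -> exists b, pos b x.
  move=> xU; have [px|] := boolP (pos true x); first by exists true.
  rewrite negb_forall_in => /existsP[y /andP[yU]].
  rewrite negb_imply => /andP[/andP[exy nxy] ag].
  exists false; apply/forall_inP => z zU; apply/implyP => /andP[exz nxz].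
  rewrite (straight_rank_agree sf sg xU zU yU exz exy nxz nxy).
  by move: ag; case: agree.
have step b : {in U &, forall x y, e x y -> pos b x -> pos b y}.
  move=> x y xU yU exy px; have [E|nxy] := eqVneq (f x) (f y); last first.
    have [b' py] := loc y yU; suff <- : b' = b by [].
    have := posP _ _ _ px yU exy nxy; rewrite e_sym in exy; rewrite eq_sym in nxy.
    have := posP _ _ _ py xU exy nxy; rewrite /agree; have := eq_fg x y xU yU; lia.
  (* Now [x] and [y] tie, so they are twins, and the edges leaving the block at [y] have
     counterparts at [x]. *)
  apply/forall_inP => z zU; apply/implyP => /andP[eyz nyz].
  have nxz : f x != f z by rewrite E.
  have exz : e x z.
    have N : closed_nbh U e y = closed_nbh U e x by case: sf => tw _;
      apply/eqP; rewrite -tw ?E.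
    by apply: (twin_adjacent yU zU N eyz); apply: contraNneq nxz => ->.
  have := posP _ _ _ px zU exz nxz; rewrite /agree E.
  by have := eq_fg x y xU yU; rewrite E eqxx => /esym/eqP ->.
have [b0 p0] := loc x0 x0U.
have p x : x \in U -> pos b0 x by move=> xU; apply: (U_conn (step b0) x0U xU p0).
case: b0 {p0} p => p; [left|right].
  have lift : {in U &, forall x y, f x < f y -> g x < g y}.
    apply: (@straight_rank_lift f (fun x y => g x < g y)) => //.
      by move=> y x z; apply: ltn_trans.
    move=> x y xU yU exy lxy; have := posP _ _ _ (p x xU) yU exy.
    by rewrite neq_ltn lxy /agree => /(_ isT); rewrite lxy; lia.
  move=> x y xU yU; have := lift x y xU yU; have := lift y x yU xU.
  by have := eq_fg x y xU yU; lia.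
have lift : {in U &, forall x y, f x < f y -> g y < g x}.
  apply: (@straight_rank_lift f (fun x y => g y < g x)) => //.
    by move=> y x z h1 h2; apply: ltn_trans h2 h1.
  move=> x y xU yU exy lxy; have := posP _ _ _ (p x xU) yU exy.
  rewrite neq_ltn lxy /agree => /(_ isT); rewrite lxy.
  by have := eq_fg x y xU yU; lia.
move=> x y xU yU; have := lift x y xU yU; have := lift y x yU xU.
by have := eq_fg x y xU yU; lia.
Qed.

End Uniqueness.

(** * Reversal, restriction and concatenation *)

Section Operations.
Variable T : finType.
Implicit Types (U V W B C : {set T}) (psi phi chi : seq {set T}) (e :
  rel T) (f g : T -> nat).

Definition same_order U psi phi := {in U &, forall x y, wlt psi x y = wlt phi x y}.
Definition reverse_order U psi phi :=
  {in U &, forall x y, wlt psi x y = wlt phi y x}.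

Lemma same_order_restrict V psi : same_order V psi (restrict psi V).
Proof. by move=> x y xV yV; rewrite wlt_restrict. Qed.

Lemma reverse_order_rev U psi :
  weak_linear_order U psi -> reverse_order U psi (rev psi).
Proof. by move=> w x y xU yU; rewrite (wlt_rev w). Qed.

Lemma compatible_same U psi psi' phi phi' :
  same_order U psi psi' -> same_order U phi phi' ->
  compatible U psi phi -> compatible U psi' phi'.
Proof.
move=> h h' /forall_inP c; apply/forall_inP => x xU; apply/forall_inP => y yU.
by rewrite -h // -h' //; have /forall_inP := c _ xU; apply.
Qed.

Lemma compatible_reverse U psi psi' phi phi' :
  reverse_order U psi psi' -> reverse_order U phi phi' ->
  compatible U psi phi -> compatible U psi' phi'.
Proof.
move=> h h' /forall_inP c; apply/forall_inP => x xU; apply/forall_inP => y yU.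
by rewrite -h // -h' //; have /forall_inP := c _ yU; apply.
Qed.

Lemma compatible_subset U V psi phi :
  V \subset U -> compatible U psi phi -> compatible V psi phi.
Proof.
move=> /subsetP VU /compatibleP c; apply/compatibleP => x y xV yV.
by apply: c; apply: VU.
Qed.

Lemma compatible_restrict U V psi phi : V \subset U ->
  compatible U psi phi -> compatible V (restrict psi V) (restrict phi V).
Proof.
move=> VU c; apply: compatible_same (compatible_subset VU c);
  exact: same_order_restrict.
Qed.

Lemma compatible_meet U psi phi chi :
  weak_linear_order U psi -> weak_linear_order U phi -> compatible U psi phi ->
  compatible U chi psi -> compatible U chi phi -> compatible U chi (meet psi phi).
Proof.
move=> w1 w2 c /compatibleP c1 /compatibleP c2; apply/compatibleP => x y xU yU xy.
have := c1 x y xU yU xy; have := c2 x y xU yU xy.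
have := meet_wlt w1 w2 c yU xU; rewrite /wlt /wle; lia.
Qed.

Lemma straight_rank_same U e f g : {in U &, forall x y,
  (f x < f y) = (g x < g y)} ->
  straight_rank U e f -> straight_rank U e g.
Proof.
move=> h [tw um]; split=> [x y xU yU|x y z xU yU zU].
  by rewrite -tw //; have := h x y xU yU; have := h y x yU xU; lia.
by rewrite -!h //; apply: um.
Qed.

Lemma straight_rank_reverse U e f g : symmetric e ->
  {in U &, forall x y, (f x < f y) = (g y < g x)} ->
  straight_rank U e f -> straight_rank U e g.
Proof.
move=> es h [tw um]; split=> [x y xU yU|x y z xU yU zU].
  by rewrite -tw //; have := h x y xU yU; have := h y x yU xU; lia.
rewrite -!h // => yx zy exz; rewrite andbC es (es x).
by apply: um zy yx _; rewrite // es.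
Qed.

(** As [V] is closed under adjacency, its vertices have the same closed neighborhoods in [V] as in
    [U]. *)
Lemma straight_rank_closed U V e f : V \subset U ->
  {in V & U, forall x y, e x y -> y \in V} ->
  straight_rank U e f -> straight_rank V e f.
Proof.
move=> /subsetP VU cl [tw um];
  have N x : x \in V -> closed_nbh V e x = closed_nbh U e x.
  move=> xV; apply/setP => y; rewrite !inE; apply/andP/andP => -[yV h];
    first by rewrite VU.
  by split=> //; case/orP: h => [/eqP -> //|]; apply: cl.
split=> [x y xV yV|x y z xV yV zV]; first by rewrite !N // tw // VU.
by apply: um; apply: VU.
Qed.

Lemma straight_enumeration_rev U e phi : symmetric e ->
  straight_enumeration U e phi -> straight_enumeration U e (rev phi).
Proof.
move=> es /(straight_enumerationP _ _ es)[w s];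
  apply/(straight_enumerationP _ _ es).
split; first exact: weak_linear_order_rev.
by apply: straight_rank_reverse s => //; apply: reverse_order_rev.
Qed.

Lemma straight_enumeration_restrict U V e phi : symmetric e -> V \subset U ->
  {in V & U, forall x y, e x y -> y \in V} ->
  straight_enumeration U e phi -> straight_enumeration V e (restrict phi V).
Proof.
move=> es VU cl /(straight_enumerationP _ _ es)[w s];
  apply/(straight_enumerationP _ _ es).
split; first exact: weak_linear_order_restrict w.
by apply: straight_rank_same (straight_rank_closed VU cl s);
  apply: same_order_restrict.
Qed.

Lemma eq_straight_enumeration U e e' phi : symmetric e -> symmetric e' ->
  {in U &, forall x y, e x y = e' x y} ->
  straight_enumeration U e phi -> straight_enumeration U e' phi.
Proof.
move=> es es' ee' /(straight_enumerationP _ _ es)[w s];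
  apply/(straight_enumerationP _ _ es').
by split=> //; apply: eq_straight_rank s.
Qed.

(** Without edges every block is a singleton and no umbrella constraint remains, so any linear order
    is straight; an extension of [psi] is moreover compatible with [psi]. *)
Lemma straight_enumeration_edgeless U e psi : symmetric e ->
  {in U &, forall x y, x != y -> ~~ e x y} -> weak_linear_order U psi ->
  straight_enumeration U e (linear_extension U psi).
Proof.
move=> es e0 w; apply/(straight_enumerationP _ _ es).
split; first exact: linear_extension_wlo.
have N x : x \in U -> closed_nbh U e x = [set x].
  move=> xU; apply/setP => y; rewrite !inE; case: eqVneq => [->|yx] /=;
    first by rewrite xU.
  by case yU: (y \in U) => //=; apply/negbTE/e0; rewrite // eq_sym.
split=> [x y xU yU|x y z xU yU zU xy yz].
  by rewrite -/(weq _ x y) (linear_extension_weq w) // !N // (inj_eq set1_inj).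
have xz : x != z by apply: contraTneq (ltn_trans xy yz) => ->; rewrite ltnn.
by rewrite (negbTE (e0 _ _ xU zU xz)).
Qed.

Lemma rank_catl U psi phi x : weak_linear_order U psi -> x \in U ->
  rank (psi ++ phi) x = rank psi x.
Proof. by move=> w xU; rewrite rank_cat (rank_ltn w xU). Qed.

Lemma rank_catr U psi phi x : weak_linear_order U psi -> x \notin U ->
  rank (psi ++ phi) x = size psi + rank phi x.
Proof. by move=> w xU; rewrite rank_cat (rank_notin w xU) ltnn. Qed.

(** Closed neighborhoods are unchanged by the union, and no edge joins the two parts, so any vertex
    placed between the ends of an edge lies in the same part as they do. *)
Lemma straight_enumeration_cat U V e psi phi : symmetric e -> [disjoint U & V] ->
  {in U & V, forall x y, ~~ e x y} ->
  straight_enumeration U e psi -> straight_enumeration V e phi ->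
  straight_enumeration (U :|: V) e (psi ++ phi).
Proof.
move=> es dUV e0 /(straight_enumerationP _ _ es)[w1 [tw1 um1]].
move=> /(straight_enumerationP _ _ es)[w2 [tw2 um2]].
apply/(straight_enumerationP _ _ es); split; first exact: weak_linear_order_cat.
have VnU x : x \in V -> x \notin U by move=> xV; rewrite (disjointFl dUV xV).
have UnV x : x \in U -> x \notin V by move=> xU; rewrite (disjointFr dUV xU).
have N1 x : x \in U -> closed_nbh (U :|: V) e x = closed_nbh U e x.
  move=> xU; apply/setP => y; rewrite !inE; case yU: (y \in U) => //=.
  case yV: (y \in V) => //=; rewrite (negbTE (e0 _ _ xU yV)) orbF.
  by apply/eqP => E; rewrite E xU in yU.
have N2 x : x \in V -> closed_nbh (U :|: V) e x = closed_nbh V e x.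
  move=> xV; apply/setP => y; rewrite !inE; case yV: (y \in V) => //=;
    first by rewrite orbT.
  case yU: (y \in U) => //=; rewrite es (negbTE (e0 _ _ yU xV)) orbF.
  by apply/eqP => E; rewrite E xV in yV.
have N12 x y : x \in U -> y \in V -> closed_nbh U e x <> closed_nbh V e y.
  by move=> xU yV /setP/(_ x); rewrite !inE xU eqxx /= (negbTE (UnV _ xU)).
have r1 x : x \in U -> rank (psi ++ phi) x = rank psi x := rank_catl phi w1.
have r2 x : x \in V -> rank (psi ++ phi) x = size psi + rank phi x.
  by move/VnU; apply: rank_catr.
have lt x : x \in U -> rank psi x < size psi := rank_ltn w1.
split=> [x y|x y z].
  case/setUP=> [xU|xV] /setUP[yU|yV].
  - by rewrite !N1 // !r1 // tw1.
  - rewrite N1 // N2 // r1 // r2 //; have := lt _ xU; have := N12 _ _ xU yV.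
    by move/eqP/negbTE=> ->; lia.
  - rewrite (N2 x) // (N1 y) // (r2 x) // (r1 y) //; have := lt _ yU;
    have := N12 _ _ yU xV.
    by move/eqP; rewrite eq_sym => /negbTE ->; lia.
  - by rewrite !N2 // !r2 // eqn_add2l tw2.
case/setUP=> [xU|xV] yUV /setUP[zU|zV].
- case/setUP: yUV => [yU|yV]; first by rewrite !r1 //; apply: um1.
  by rewrite (r2 y) // (r1 z) //; have := lt _ zU; lia.
- by move=> _ _ exz; have := e0 _ _ xU zV; rewrite exz.
- by move=> _ _ exz; have := e0 _ _ zU xV; rewrite es exz.
case/setUP: yUV => [yU|yV]; last by rewrite !r2 // !ltn_add2l; apply: um2.
by rewrite (r2 x) // (r1 y) //; have := lt _ yU; lia.
Qed.

End Operations.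

(** * Connected components and their order *)

Section Components.
Variables (T : finType) (U : {set T}) (e : rel T).
Hypothesis e_sym : symmetric e.
Implicit Types (V W : {set T}) (psi phi : seq {set T}).

Let E : rel T := [rel x y | [&& x \in U, y \in U & e x y]].

Let E_sym : connect_sym E.
Proof. by apply: sym_connect_sym => x y; rewrite /E /= e_sym andbCA. Qed.

Lemma components_partition : partition (components U e) U.
Proof.
apply: equivalence_partitionP => x y z _ _ _; split; first exact: connect0.
by move=> xy; apply: (same_connect E_sym xy).
Qed.

Lemma component_subset V : V \in components U e -> V \subset U.
Proof. by case/imsetP=> x _ ->; apply/subsetP => y; rewrite inE => /andP[]. Qed.

Lemma component_neq0 V : V \in components U e -> V != set0.
Proof.
move=> VC; case/and3P: components_partition => _ _; apply: contraNneq => <-.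
exact: VC.
Qed.

Lemma component_disjoint V W : V \in components U e -> W \in components U e ->
  V != W -> [disjoint V & W].
Proof.
by move=> VC WC; case/and3P: components_partition => _ /trivIsetP h _; apply: h.
Qed.

Lemma component_closed V : V \in components U e ->
  {in V & U, forall x y, e x y -> y \in V}.
Proof.
case/imsetP=> x0 x0U -> x y; rewrite !inE => /andP[xU x0x] yU exy.
by rewrite yU (connect_trans x0x) // connect1 //= xU yU.
Qed.

Lemma component_connected V : V \in components U e -> connected_on V e.
Proof.
move=> VC P step x y xV yV Px.
have xy : connect E x y.
  case/imsetP: VC xV yV => x0 _ ->; rewrite !inE => /andP[_ x0x] /andP[_].
  by apply: connect_trans; rewrite E_sym.
case/connectP: xy yV => p; elim: p x xV Px => [|z p IH] x xV Px /=;
  first by move=> _ ->.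
case/andP=> /and3P[xU zU exz] pth yE yV.
have zV := component_closed VC xV zU exz.
exact: (IH z zV (step x z xV zV exz Px)).
Qed.

(** An edge inside [V] passing over a vertex [y] of [W] would make [y] adjacent to [V], so by
    connectedness all of [V] stays before [y]. The same argument inside [W] then replaces [y] by any
    other vertex of [W]. *)
Lemma straight_rank_components f V W x y : straight_rank U e f ->
  V \in components U e -> W \in components U e -> V != W ->
  x \in V -> y \in W -> f x <= f y -> {in V & W, forall a b, f a < f b}.
Proof.
move=> [tw um] VC WC VW xV yW xy.
have VU : {subset V <= U} by apply/subsetP/component_subset.
have WU : {subset W <= U} by apply/subsetP/component_subset.
have dVW := component_disjoint VC WC VW.
have nb a b : a \in V -> b \in W -> f a != f b /\ ~~ e a b.
  move=> aV bW; have nab : ~~ e a b.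
    by apply/negP => eab; have := component_closed VC aV (WU _ bW) eab;
      rewrite (disjointFl dVW bW).
  split=> //; rewrite tw ?(VU a) ?(WU b) //; apply/eqP => /setP/(_ b).
  rewrite !inE (WU b bW) eqxx (negbTE nab) orbF andTb => /eqP ab.
  by move: bW; rewrite ab (disjointFr dVW).
have aux (a : T) : a \in V -> f a < f y.
  move=> aV; apply: (component_connected VC (P := fun v => f v < f y) _ xV aV).
    move=> u v uV vV euv lu; rewrite ltnNge leq_eqVlt negb_or eq_sym.
    have [-> _] := nb v y vV yW; apply/negP => lv.
    have /andP[] := um u y v (VU _ uV) (WU _ yW) (VU _ vV) lu lv euv.
    by have [_ /negbTE ->] := nb u y uV yW.
  by rewrite ltn_neqAle xy; have [-> _] := nb x y xV yW.
move=> a b aV bW; apply: (component_connected WC (P := fun w => f a < f w) _ yW bW).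
  move=> u v uW vW euv lu; rewrite ltnNge leq_eqVlt negb_or.
  have [+ _] := nb a v aV vW; rewrite eq_sym => ->; apply/negP => lv.
  have evu : e v u by rewrite e_sym.
  have /andP[] := um v a u (WU _ vW) (VU _ aV) (WU _ uW) lv lu evu.
  by have [_ /negbTE] := nb a v aV vW; rewrite e_sym => ->.
exact: aux.
Qed.

(** The components are sorted by the position in [phi] of one of their vertices; as they occupy
    separate intervals of positions, the choice of that vertex is immaterial. *)
Lemma straight_enumeration_component_order phi psi :
  straight_enumeration U e phi -> compatible U phi psi ->
  exists cs, component_order U e psi cs.
Proof.
case/(straight_enumerationP _ _ e_sym) => w s /compatibleP c.
pose key V := if [pick x in V] is Some x then rank phi x else 0.
have keyP V : V \in components U e -> exists2 x, x \in V & key V = rank phi x.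
  move=> /component_neq0/set0Pn[x xV]; rewrite /key;
    case: pickP => [y yV|/(_ x)]; first by exists y.
  by rewrite /= xV.
pose cs := sort (relpre key leq) (enum (components U e)).
have csE V : (V \in cs) = (V \in components U e) by rewrite mem_sort mem_enum.
exists cs; split; first by rewrite sort_uniq enum_uniq.
  by apply/setP => V; rewrite inE csE.
have tr : transitive (relpre key leq) by move=> V1 V2 V3; apply: leq_trans.
have := sort_sorted (fun V W => leq_total (key V) (key W)) (enum (components U e)).
rewrite -/cs (sorted_pairwise tr) => pw.
have ucs : uniq cs by rewrite sort_uniq enum_uniq.
have {pw} : pairwise [rel V W | (V != W) && (key V <= key W)] cs.
  by rewrite pairwise_relI -uniq_pairwise ucs.
apply: (sub_in_pairwise (P := mem (components U e))); last by apply/allP => V;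
  rewrite csE.
move=> V W VC WC /= /andP[VW].
have [x xV ->] := keyP _ VC; have [y yW ->] := keyP _ WC => xy.
apply/forall_inP => a aV; apply/forall_inP => b bW.
apply: c; [exact: subsetP (component_subset VC) _ aV
          |exact: subsetP (component_subset WC) _ bW|].
exact: (straight_rank_components s VC WC VW xV yW xy).
Qed.

End Components.

(** Suppose the two enumerations are mutual reversals and [psi] separates some pair in [V].
    Compatibility of both with [psi] forces this pair to tie, then all of [V] ties, and the reversal
    is the same order. *)
Lemma straight_enumeration_unique (T : finType) (V : {set T}) (e : rel T)
    (psi chi chi' : seq {set T}) :
  symmetric e -> connected_on V e ->
  straight_enumeration V e chi -> straight_enumeration V e chi' ->
  compatible V chi psi -> compatible V chi' psi ->
  same_order V chi chi' \/
  reverse_order V chi chi' /\ {in V &, forall x y, ~~ wlt psi x y}.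
Proof.
move=> es conn /(straight_enumerationP _ _ es)[_ s1].
move=> /(straight_enumerationP _ _ es)[_ s2].
move=> /compatibleP c1 /compatibleP c2.
have [same|rv] := straight_rank_unique es conn s1 s2; first by left.
have [/existsP[x /andP[xV /existsP[y /andP[yV xy]]]]|none] :=
  boolP [exists x in V, exists y in V, wlt psi x y]; last first.
  right; split=> // x y xV yV; apply: contraNN none => xy.
  by apply/existsP; exists x; rewrite xV; apply/existsP; exists y; rewrite yV.
have tie a b : a \in V -> b \in V -> wlt psi a b -> rank chi a = rank chi b.
  move=> aV bV ab; have := c1 b a bV aV; have := c2 b a bV aV.
  have := rv a b aV bV; have := rv b a bV aV.
  by move: ab; rewrite /wlt /wle;
    case: (ltngtP (rank chi a) (rank chi b)) => //; lia.
(* In [psi], every [z] is strictly after [x] or strictly before [y], so it ties with one of them in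
   [chi]. *)
have all_tie z : z \in V -> rank chi z = rank chi x.
  move=> zV; have xyE := tie _ _ xV yV xy.
  have [xz|zx] := ltnP (rank psi x) (rank psi z); first by rewrite (tie x z).
  by rewrite xyE; apply: tie => //; apply: leq_ltn_trans zx xy.
left=> a b aV bV; have := rv b a bV aV; rewrite /wlt !all_tie // !ltnn => <-.
Qed.

Local Open Scope ring_scope.

(** * Level graphs and the output of the procedure *)

Section Matrices.
Variables (R : realFieldType) (n : nat).
Implicit Types (A : 'M[R]_n) (U V W : {set 'I_n}) (t : R).
Implicit Types (psi phi chi Phi cs : seq {set 'I_n}) (r : option (seq {set 'I_n})).

(** Level graphs are indexed by a real threshold: thresholds keep their meaning when passing to a
    submatrix or to [peel], while level numbers shift. *)
Definition threshold_graph A t : rel 'I_n := [rel x y | (x != y) && (t <= A x y)].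

Lemma sym_entry A x y : A^T = A -> A x y = A y x.
Proof. by move=> s; rewrite -{1}s mxE. Qed.

Lemma support_graph_sym A : A^T = A -> symmetric (support_graph A).
Proof. by move=> s x y; rewrite /support_graph /= (sym_entry x y s) eq_sym. Qed.

Lemma threshold_graph_sym A t : A^T = A -> symmetric (threshold_graph A t).
Proof. by move=> s x y; rewrite /threshold_graph /= (sym_entry x y s) eq_sym. Qed.

Lemma peel_sym V A : A^T = A -> (peel V A)^T = peel V A.
Proof. by move=> s; apply/matrixP => x y; rewrite !mxE (sym_entry x y s). Qed.

Lemma peel_ge0 V A : (forall x y, 0 <= A x y) -> forall x y, 0 <= peel V A x y.
Proof. by move=> h x y; rewrite mxE; case: ifP. Qed.

Lemma mem_levels_entry U A x y : x \in U -> y \in U -> A x y \in levels U A.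
Proof. by move=> xU yU; apply/mem_levels; right; exists x, y. Qed.

Lemma levels_ge0 U A t : (forall x y, 0 <= A x y) -> t \in levels U A -> 0 <= t.
Proof. by move=> h /mem_levels[->|[x [y [_ _ ->]]]]. Qed.

Lemma le_level U A i j :
  (i <= j < size (levels U A))%N -> level U A i <= level U A j.
Proof.
case/andP=> ij jS.
apply: (sorted_leq_nth le_trans le_refl 0) => //; rewrite ?inE //;
  last exact: leq_ltn_trans jS.
exact: sort_le_sorted.
Qed.

Lemma size_levels_gt0 U A : (0 < size (levels U A))%N.
Proof.
have : 0 \in levels U A by apply/mem_levels; left.
by case: levels.
Qed.

Lemma level0 U A : (forall x y, 0 <= A x y) -> level U A 0 = 0.
Proof.
move=> h; have z : 0 \in levels U A by apply/mem_levels; left.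
apply/eqP; rewrite eq_le (levels_ge0 h (mem_nth 0 (size_levels_gt0 U A))) andbT.
by rewrite -[leRHS](nth_index 0 z) le_level // index_mem.
Qed.

Lemma index_level_gt0 U A t : (forall x y, 0 <= A x y) ->
  0 < t -> t \in levels U A -> (0 < index t (levels U A))%N.
Proof.
move=> h t0 tl; rewrite lt0n; apply: contraTneq t0 => E.
by rewrite -(nth_index 0 tl) E -/(level U A 0) level0 // ltxx.
Qed.

Lemma level1_le U A t : (forall x y, 0 <= A x y) ->
  0 < t -> t \in levels U A -> 0 < level U A 1 <= t.
Proof.
move=> h t0 tl; have i0 := index_level_gt0 h t0 tl.
rewrite -[leRHS](nth_index 0 tl) le_level ?index_mem ?i0 // andbT.
by apply: level_pos => //; apply: leq_ltn_trans i0 _; rewrite index_mem.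
Qed.

Lemma level1_ge0 U A : (forall x y, 0 <= A x y) -> 0 <= level U A 1.
Proof.
move=> h; have [s|s] := ltnP 1 (size (levels U A)); first exact/ltW/level_pos.
by rewrite /level nth_default.
Qed.

Lemma level_gt0 U A l : (forall x y, 0 <= A x y) ->
  (1 <= l <= max_level U A)%N -> 0 < level U A l.
Proof.
move=> h /andP[l1 lm]; have s0 := size_levels_gt0 U A.
have ls : (l < size (levels U A))%N by rewrite -(prednK s0) ltnS.
apply: lt_le_trans (le_level (i := 1) _); last by rewrite l1.
by apply: level_pos => //; apply: leq_ltn_trans ls.
Qed.

Lemma threshold_graph_support V A t : (forall x y, 0 <= A x y) ->
  0 < t -> t <= level V A 1 ->
  {in V &, forall x y, support_graph A x y = threshold_graph A t x y}.
Proof.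
move=> h t0 t1 x y xV yV; rewrite /support_graph /threshold_graph /=;
  congr (_ && _); apply/idP/idP => [n0|tA].
  have p : 0 < A x y by rewrite lt_neqAle eq_sym n0 h.
  by apply: le_trans t1 _; case/andP: (level1_le h p (mem_levels_entry A xV yV)).
by apply: contraTneq tA => ->; rewrite -ltNge.
Qed.

(** The altered entries go from [level V A 1] to [0], both below [t], so no edge changes. *)
Lemma threshold_graph_peel V A t : (forall x y, 0 <= A x y) ->
  level V A 1 < t -> threshold_graph (peel V A) t =2 threshold_graph A t.
Proof.
move=> h t1 x y; rewrite /threshold_graph /= mxE.
case: (A x y =P level V A 1) => [->|//]; congr (_ && _).
by rewrite !leNgt t1 (le_lt_trans (level1_ge0 V h) t1).
Qed.

(** The positive entries left by [peel] on [V] are original entries exceeding the smallest positive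
    one; hence the thresholds of the recursive call are among those of the caller. *)
Lemma levels_peel U V A t : (forall x y, 0 <= A x y) -> V \subset U -> 0 < t ->
  t \in levels V (peel V A) -> level V A 1 < t /\ t \in levels U A.
Proof.
move=> h /subsetP VU t0 /mem_levels[E|[x [y [xV yV]]]];
  first by rewrite E ltxx in t0.
rewrite mxE; case: (A x y =P level V A 1) => [_ E|/eqP n1 E];
  first by rewrite E ltxx in t0.
split; last by rewrite E mem_levels_entry ?VU.
rewrite E in t0 *; case/andP: (level1_le h t0 (mem_levels_entry A xV yV)) => _.
by rewrite lt_neqAle eq_sym n1.
Qed.

(** Merges the two successful branches of [refine]: [chi] is [phi] or its reversal. *)
Lemma refine_meet V A psi phi Phi : A^T = A ->
  weak_linear_order V psi ->
  straight_enumeration V (support_graph A) phi -> refine V psi phi = Some Phi ->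
  exists chi, [/\ straight_enumeration V (support_graph A) chi,
    weak_linear_order V chi, compatible V psi chi & Phi = meet psi chi].
Proof.
move=> s w se; have es := support_graph_sym s.
have [wp _] := (straight_enumerationP _ _ es).1 se.
rewrite /refine; case: ifP => [c [<-]|_]; first by exists phi.
case: ifP => // c [<-]; exists (rev phi); split=> //.
  exact: straight_enumeration_rev.
exact: weak_linear_order_rev.
Qed.

(** The last clause covers all positive thresholds, not only the values occurring in the submatrix,
    so that outputs of components with different entries can be concatenated. *)
Definition robinson_output A U psi Phi : Prop :=
  [/\ weak_linear_order U Phi, refines U Phi psi &
      forall t, 0 < t -> exists phi,
        straight_enumeration U (threshold_graph A t) phi /\ compatible U Phi phi].

Lemma robinson_output_nil A psi : robinson_output A set0 psi [::].
Proof.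
have w : weak_linear_order (set0 : {set 'I_n}) [::].
  by apply/weak_linear_orderP; split=> // x; rewrite inE.
split=> // [x y|t t0]; first by rewrite inE.
exists [::]; split; last by apply/compatibleP => x y; rewrite inE.
split=> //; apply/setP => B; rewrite inE; apply/esym/imsetP => -[x].
by rewrite inE.
Qed.

Lemma compatible_cat U V (Phi Psi phi chi : seq {set 'I_n}) : [disjoint U & V] ->
  weak_linear_order U Phi -> weak_linear_order V Psi ->
  weak_linear_order U phi -> weak_linear_order V chi ->
  compatible U Phi phi -> compatible V Psi chi ->
  compatible (U :|: V) (Phi ++ Psi) (phi ++ chi).
Proof.
move=> dUV w1 w2 w3 w4 /compatibleP c1 /compatibleP c2.
have VnU x : x \in V -> x \notin U by move=> xV; rewrite (disjointFl dUV xV).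
apply/compatibleP => x y /setUP[xU|/[dup] xV /VnU xU] /setUP[yU|/[dup] yV /VnU
  yU]; rewrite /wlt /wle.
- by rewrite !(rank_catl _ _ xU) // !(rank_catl _ _ yU) //; apply: c1.
- move=> _; rewrite (rank_catl _ w3 xU) (rank_catr _ w3 yU).
  by have := rank_ltn w3 xU; lia.
- rewrite (rank_catr _ w1 xU) (rank_catl _ w1 yU).
  by have := rank_ltn w1 yU; lia.
- rewrite !(rank_catr _ _ xU) // !(rank_catr _ _ yU) // ltn_add2l leq_add2l.
  exact: c2.
Qed.

Lemma robinson_output_cat A U V psi Phi Psi : A^T = A -> (forall x y, 0 <= A x y) ->
  [disjoint U & V] -> {in U & V, forall x y, ~~ support_graph A x y} ->
  {in U & V, forall x y, wle psi x y} ->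
  robinson_output A U psi Phi -> robinson_output A V psi Psi ->
  robinson_output A (U :|: V) psi (Phi ++ Psi).
Proof.
move=> s h dUV e0 le [w1 r1 st1] [w2 r2 st2].
have VnU x : x \in V -> x \notin U by move=> xV; rewrite (disjointFl dUV xV).
split; first exact: weak_linear_order_cat.
  move=> x y /setUP[xU|/[dup] xV /VnU xU] /setUP[yU|/[dup] yV /VnU yU];
    rewrite {2}/wlt.
  - by rewrite !(rank_catl _ w1) //; apply: r1.
  - by rewrite (rank_catl _ w1 xU) (rank_catr _ w1 yU); have := rank_ltn w1 xU; lia.
  - by move: (le y x yU xV); rewrite /wle /wlt; lia.
  - by rewrite !(rank_catr _ w1) // ltn_add2l; apply: r2.
move=> t t0; have [phi [sphi cphi]] := st1 t t0; have [chi [schi cchi]] := st2 t t0.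
have es := threshold_graph_sym t s.
exists (phi ++ chi); split.
  apply: straight_enumeration_cat => // x y xU yV.
  apply: contraNN (e0 _ _ xU yV);
    rewrite /threshold_graph /support_graph /= => /andP[-> tA] /=.
  by apply: contraTneq tA => ->; rewrite -ltNge.
have [w3 _] := (straight_enumerationP _ _ es).1 sphi.
have [w4 _] := (straight_enumerationP _ _ es).1 schi.
exact: compatible_cat.
Qed.

Lemma bigcup_seqP cs x :
  reflect (exists2 V, V \in cs & x \in V) (x \in \bigcup_(V <- cs) V).
Proof.
elim: cs => [|W cs IH]; first by rewrite big_nil inE; constructor=> -[].
rewrite big_cons inE; apply: (iffP orP) => [[xW|/IH[V Vc xV]]|[V]].
- by exists W; rewrite ?mem_head.
- by exists V; rewrite // inE Vc orbT.
rewrite inE => /orP[/eqP ->|Vc xV]; first by left.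
by right; apply/IH; exists V.
Qed.

(** Covers both ways of completing a component, [psi'] standing for the restriction of [psi] to [V].
    Thresholds up to [level V A 1] are served by [chi], higher ones by the recursive output or, when
    [peel] leaves no edge, by a linear extension. *)
Lemma robinson_output_meet A V psi psi' chi : A^T = A -> (forall x y, 0 <= A x y) ->
  weak_linear_order V psi' -> same_order V psi psi' ->
  straight_enumeration V (support_graph A) chi -> compatible V psi' chi ->
  (off_diagonal_zero V (peel V A) -> robinson_output A V psi (meet psi' chi)) /\
  (forall Phi, robinson_output (peel V A) V (meet psi' chi) Phi ->
     robinson_output A V psi Phi).
Proof.
move=> s h w ss se c; have es := support_graph_sym s.
have [wc _] := (straight_enumerationP _ _ es).1 se.
have rp : refines V (meet psi' chi) psi.
  by move=> x y xV yV; rewrite ss //; apply: (refines_meetl w wc).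
have rc := refines_meetr w wc c.
have low t Phi : refines V Phi (meet psi' chi) -> 0 < t -> t <= level V A 1 ->
    exists phi, straight_enumeration V (threshold_graph A t) phi /\ compatible
      V Phi phi.
  move=> r t0 t1; exists chi; split.
    apply: eq_straight_enumeration se => //; first exact: threshold_graph_sym.
    exact: threshold_graph_support.
  exact: refines_compatible (refines_trans r rc).
have wm := meet_wlo w wc.
split=> [off|Phi [w' r' st']].
  split=> // t t0; have [t1|t1] := leP t (level V A 1);
    first exact: (low t (meet psi' chi)).
  exists (linear_extension V (meet psi' chi)); split.
    apply: straight_enumeration_edgeless => //; first exact: threshold_graph_sym.
    move=> x y xV yV xy; rewrite -(threshold_graph_peel h t1) /threshold_graph
      /= xy /= -ltNge.
    have /forall_inP/(_ y yV) := forall_inP off x xV.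
    by rewrite xy /= => /eqP ->.
  apply/compatible_sym/refines_compatible/refines_meetl => //.
  exact: weak_linear_order_singletons.
split=> //; first exact: refines_trans r' rp.
move=> t t0; have [t1|t1] := leP t (level V A 1); first exact: low.
have [phi [sp cp]] := st' t t0; exists phi; split=> //.
apply: eq_straight_enumeration sp; try exact: threshold_graph_sym;
  first exact/threshold_graph_sym/peel_sym.
by move=> x y _ _; apply: threshold_graph_peel.
Qed.

End Matrices.

(* Correctness by induction on runs *)
Scheme robinson_mutual_ind := Minimality for robinson Sort Prop
  with robinson_loop_mutual_ind := Minimality for robinson_loop Sort Prop
  with robinson_component_mutual_ind := Minimality for robinson_component Sort Prop.

Section Correctness.
Variables (R : realFieldType) (n : nat).
Implicit Types (A : 'M[R]_n) (U V W : {set 'I_n}) (s t : R).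
Implicit Types (psi chi Phi cs : seq {set 'I_n}) (phi : R -> seq {set 'I_n}).

(** Mutual induction on the run. The loop claim concerns the union of a list of sets that are
    pairwise disjoint, non-adjacent and ordered by [psi], a form that survives removal of the first
    one. *)
Theorem robinson_success A U psi r : robinson A U psi r ->
  A^T = A -> (forall x y, 0 <= A x y) -> weak_linear_order U psi ->
  forall Phi, r = Some Phi -> robinson_output A U psi Phi.
Proof.
move: A U psi r; apply: (@robinson_mutual_ind R n (fun A U psi r => A^T = A ->
     (forall x y, 0 <= A x y) -> weak_linear_order U psi ->
     forall Phi, r = Some Phi -> robinson_output A U psi Phi)
  (fun A psi cs r => A^T = A -> (forall x y, 0 <= A x y) ->
     (forall V, V \in cs -> weak_linear_order V (restrict psi V)) ->
     pairwise (fun V W => [disjoint V & W] && [forall x in V, forall y in W,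
       ~~ support_graph A x y]) cs ->
     pairwise (set_wle psi) cs ->
     forall Phi, r = Some Phi -> robinson_output A (\bigcup_(V <- cs) V) psi Phi)
  (fun A psi V r => A^T = A -> (forall x y, 0 <= A x y) ->
     weak_linear_order V (restrict psi V) ->
     forall Phi, r = Some Phi -> robinson_output A V psi Phi)).
- by [].
- move=> A U psi cs r [ucs csE pw] _ IH sA h w Phi rE.
  have es := support_graph_sym sA.
  have part := components_partition U es.
  have csP V : (V \in cs) = (V \in components U (support_graph A)) by rewrite
    -csE inE.
  have -> : U = \bigcup_(V <- cs) V.
    case/and3P: part => /eqP <- _ _; apply/setP => x.
    by apply/bigcupP/bigcup_seqP => -[V Vc xV]; exists V => //;
      rewrite ?csP // -csP.
  apply: IH => // [V|].
    by rewrite csP => /component_subset VU; apply: weak_linear_order_restrict w.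
  move: ucs; rewrite uniq_pairwise;
    apply: (sub_in_pairwise (P := mem cs)) => [V W Vc Wc /= VW|]; last exact/allP.
  have [{}Vc {}Wc] : V \in components U (support_graph A) /\ W \in components U
    (support_graph A).
    by rewrite -!csP; split; [apply: Vc | apply: Wc].
  have d := component_disjoint es Vc Wc VW; rewrite d.
  apply/forall_inP => x xV; apply/forall_inP => y yW; apply/negP => xy.
  have yU := subsetP (component_subset Wc) _ yW.
  by have := component_closed Vc xV yU xy; rewrite (disjointFl d yW).
- by move=> A psi _ _ _ _ _ Phi [<-]; rewrite big_nil; apply: robinson_output_nil.
- by [].
- move=> A psi V cs Phi [Psi|//] _ IH1 _ IH2 sA h w /andP[d pd] /andP[le ple] _
  [<-].
  rewrite big_cons; apply: robinson_output_cat => //.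
  + rewrite disjoint_sym; apply/pred0P => x /=;
    apply/negP => /andP[/bigcup_seqP[W Wc xW] xV].
    by have /andP[dis _] := allP d _ Wc; rewrite (disjointFr dis xV) in xW.
  + move=> x y xV /bigcup_seqP[W Wc yW].
    by have /andP[_ /forall_inP/(_ x xV)/forall_inP] := allP d _ Wc; apply.
  + move=> x y xV /bigcup_seqP[W Wc yW].
    by have /forall_inP/(_ x xV)/forall_inP := allP le _ Wc; apply.
  + by apply: IH1 => //; apply: w; rewrite mem_head.
  + by apply: IH2 => // W Wc; apply: w; rewrite inE Wc orbT.
- by [].
- by [].
- move=> A psi V phi Phi se rf off sA h w _ [<-].
  have [chi [sc _ c ->]] := refine_meet sA w se rf.
  have [+ _] := robinson_output_meet sA h w (@same_order_restrict _ V psi) sc c.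
  exact.
- move=> A psi V phi Phi r se rf off _ IH sA h w Psi rE.
  have [chi [sc wc c PhiE]] := refine_meet sA w se rf.
  have [_] := robinson_output_meet sA h w (@same_order_restrict _ V psi) sc c.
  apply; rewrite -PhiE; apply: IH => //; first exact: peel_sym.
    exact: peel_ge0.
  by rewrite PhiE; apply: meet_wlo.
Qed.

(** Only positive values occurring in the submatrix are constrained: these are the thresholds that
    the level numbers from 1 on denote. *)
Definition compatible_family A U psi phi : Prop :=
  [/\ forall t, t \in levels U A -> 0 < t ->
        straight_enumeration U (threshold_graph A t) (phi t),
      forall s t, s \in levels U A -> 0 < s -> t \in levels U A -> 0 < t ->
        compatible U (phi s) (phi t) &
      forall t, t \in levels U A -> 0 < t -> compatible U (phi t) psi].

(** The member of the family at the smallest positive level enumerates the support graph. With no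
    positive level the graph has no edges and a linear extension of [psi] serves. *)
Lemma compatible_family_support A U psi phi : A^T = A -> (forall x y, 0 <= A x y) ->
  weak_linear_order U psi -> compatible_family A U psi phi ->
  exists chi, [/\ straight_enumeration U (support_graph A) chi,
    compatible U chi psi &
    forall t, t \in levels U A -> 0 < t -> compatible U (phi t) chi].
Proof.
move=> sA h w [st c cpsi]; have es := support_graph_sym sA.
have [s1|s1] := ltnP 1 (size (levels U A)).
  have p := level_pos h s1; have l1 : level U A 1 \in levels U A by apply: mem_nth.
  exists (phi (level U A 1)); split; last by move=> t tl t0; apply: c.
    apply: eq_straight_enumeration (st _ l1 p) => //;
      first exact: threshold_graph_sym.
    by move=> x y xU yU; apply/esym/(threshold_graph_support h p (lexx _)).
  exact: cpsi.
have none t : t \in levels U A -> 0 < t -> False.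
  move=> tl t0; have i0 := index_level_gt0 h t0 tl; rewrite -index_mem in tl.
  by have := leq_trans (leq_ltn_trans i0 tl) s1.
exists (linear_extension U psi); split.
- apply: straight_enumeration_edgeless => // x y xU yU xy.
  rewrite /support_graph /= xy /= negbK eq_le h andbT leNgt; apply/negP => p.
  exact: none (mem_levels_entry A xU yU) p.
- apply/refines_compatible/refines_meetl => //; exact: weak_linear_order_singletons.
- by move=> t tl t0; case: (none t).
Qed.

Lemma threshold_graph_closed A U V t : (forall x y, 0 <= A x y) -> 0 < t ->
  {in V & U, forall x y, support_graph A x y -> y \in V} ->
  {in V & U, forall x y, threshold_graph A t x y -> y \in V}.
Proof.
move=> h t0 cl x y xV yU; rewrite /threshold_graph /= => /andP[xy tA].
apply: (cl x) => //; rewrite /support_graph /= xy /=.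
by apply: contraTneq tA => ->; rewrite -ltNge.
Qed.

(* If the enumeration chi chosen for the component V runs opposite to the family,
   then psi is constant on V and the whole family may be reversed. *)
Lemma compatible_family_peel A U V psi phi chi : A^T = A -> (forall x y,
  0 <= A x y) ->
  weak_linear_order U psi -> V \in components U (support_graph A) ->
  straight_enumeration V (support_graph A) chi ->
    compatible V (restrict psi V) chi ->
  compatible_family A U psi phi ->
  exists phi', compatible_family (peel V A) V (meet (restrict psi V) chi) phi'.
Proof.
move=> sA h w VC sc c fam; have es := support_graph_sym sA.
have VU := component_subset VC; have cl := component_closed VC.
have [chi0 [s0 c0 cf0]] := compatible_family_support sA h w fam.
have wV := weak_linear_order_restrict VU w.
have [wc _] := (straight_enumerationP _ _ es).1 sc.
have s0V := straight_enumeration_restrict es VU cl s0.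
have c0V := compatible_restrict VU c0.
have stV t : t \in levels V (peel V A) -> 0 < t ->
    straight_enumeration V (threshold_graph (peel V A) t) (restrict (phi t) V).
  move=> tl t0; have [t1 tU] := levels_peel h VU t0 tl.
  have est := threshold_graph_sym t sA; case: fam => st _ _.
  apply: eq_straight_enumeration (straight_enumeration_restrict est VU _ (st t
    tU t0)) => //.
  - exact/threshold_graph_sym/peel_sym.
  - by move=> x y _ _; rewrite threshold_graph_peel.
  - exact: threshold_graph_closed.
have [same|[rv none]] :=
  straight_enumeration_unique es (component_connected es VC) s0V sc c0V
    (compatible_sym c).
  exists (fun t => restrict (phi t) V); split=> // [s t sl sp tl tp|t tl tp].
    have [_ sU] := levels_peel h VU sp sl; have [_ tU] := levels_peel h VU tp tl.
    by case: fam => _ cf _; apply: (compatible_restrict VU); apply: cf.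
  have [_ tU] := levels_peel h VU tp tl.
  (* On [V] the chosen [chi] has the same strict order as [chi0], with which the whole family is
     compatible. *)
  apply: compatible_meet => //.
    by case: fam => _ _ cf; apply: (compatible_restrict VU); apply: cf.
  by apply: compatible_same same (compatible_restrict VU (cf0 t tU tp)).
have wt t : t \in levels V (peel V A) -> 0 < t ->
  weak_linear_order V (restrict (phi t) V).
  move=> tl tp; have esp := threshold_graph_sym t (peel_sym V sA).
  by case: ((straight_enumerationP _ _ esp).1 (stV t tl tp)).
exists (fun t => rev (restrict (phi t) V));
  split=> [t tl tp|s t sl sp tl tp|t tl tp].
- by apply: straight_enumeration_rev (stV t tl tp);
  apply/threshold_graph_sym/peel_sym.
- have [_ sU] := levels_peel h VU sp sl; have [_ tU] := levels_peel h VU tp tl.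
  apply: compatible_reverse (reverse_order_rev (wt s sl sp)) (reverse_order_rev
    (wt t tl tp)) _.
  by case: fam => _ cf _; apply: (compatible_restrict VU); apply: cf.
have [_ tU] := levels_peel h VU tp tl.
apply: compatible_meet => //.
  apply/compatible_sym/compatibleP => x y xV yV.
  by rewrite (negbTE (none x y xV yV)).
(* Reversing both sides turns compatibility with [chi0] into compatibility of the reversed family
   with [chi]. *)
apply: compatible_reverse (reverse_order_rev (wt t tl tp)) rv _.
exact: compatible_restrict VU (cf0 t tU tp).
Qed.

(** A family yields a straight enumeration of the support graph compatible with [psi], which rules
    out every immediate failure; for a failing recursive call the family is passed down. The claims
    for loops and components keep the ambient [U], on which the family lives. *)
Theorem robinson_failure A U psi r : robinson A U psi r ->
  A^T = A -> (forall x y, 0 <= A x y) -> weak_linear_order U psi ->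
  r = None -> forall phi, ~ compatible_family A U psi phi.
Proof.
move: A U psi r; apply: (@robinson_mutual_ind R n (fun A U psi r => A^T = A ->
     (forall x y, 0 <= A x y) -> weak_linear_order U psi ->
     r = None -> forall phi, ~ compatible_family A U psi phi)
  (fun A psi cs r => A^T = A -> (forall x y, 0 <= A x y) ->
     forall U, weak_linear_order U psi ->
     {subset cs <= components U (support_graph A)} ->
     r = None -> forall phi, ~ compatible_family A U psi phi)
  (fun A psi V r => A^T = A -> (forall x y, 0 <= A x y) ->
     forall U, weak_linear_order U psi -> V \in components U (support_graph A) ->
     r = None -> forall phi, ~ compatible_family A U psi phi)).
- move=> A U psi none sA h w _ phi /(compatible_family_support sA h w)[chi [sc
  cc _]].
  have [cs co] := straight_enumeration_component_order (support_graph_sym sA) sc cc.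
  exact: none co.
- move=> A U psi cs r [_ csE _] _ IH sA h w; apply: IH => // V.
  by rewrite -csE inE.
- by [].
- by move=> A psi V cs _ IH sA h U w sub; apply: IH => //; apply: sub;
  rewrite mem_head.
- move=> A psi V cs Phi [//|] _ _ _ IH sA h U w sub _; apply: IH => // W Wc.
  by apply: sub; rewrite inE Wc orbT.
- move=> A psi V none sA h U w VC _ phi /(compatible_family_support sA h w)[chi
  [sc _ _]].
  have es := support_graph_sym sA.
  exact: none (straight_enumeration_restrict es (component_subset VC)
    (component_closed VC) sc).
- move=> A psi V chi sc rf sA h U w VC _ phi /(compatible_family_support sA h
  w)[chi0 [s0 c0 _]].
  have es := support_graph_sym sA; have VU := component_subset VC.
  have s0V := straight_enumeration_restrict es VU (component_closed VC) s0.
  have c0V := compatible_sym (compatible_restrict VU c0).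
  have [_ k0] := (straight_enumerationP _ _ es).1 s0V.
  have [wc k] := (straight_enumerationP _ _ es).1 sc.
  move: rf; rewrite /refine; case: ifP => // /negP nc; case: ifP => // /negP nr _.
  (* By uniqueness [chi] or its reversal has the order of the enumeration given by the family, so
     one of the two tests of [refine] must succeed. *)
  have [same|rv] := straight_rank_unique es (component_connected es VC) k0 k.
    by apply: nc; apply: compatible_same c0V.
  apply: nr; apply: compatible_same c0V => // x y xV yV.
  by rewrite (wlt_rev wc) //; apply: rv.
- by [].
- move=> A psi V chi Phi r sc rf _ _ IH sA h U w VC rE phi fam.
  have wV := weak_linear_order_restrict (component_subset VC) w.
  have [chi' [sc' wc' c' PhiE]] := refine_meet sA wV sc rf.
  have [phi' fam'] := compatible_family_peel sA h w VC sc' c' fam.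
  rewrite -PhiE in fam'; apply: IH fam' => //; first exact: peel_sym.
    exact: peel_ge0.
  by rewrite PhiE; apply: meet_wlo.
Qed.

End Correctness.

Theorem theorem4p4 (R : realFieldType) (n : nat) (A : 'M[R]_n)
  (psi : seq {set 'I_n})
  (psi_wlo : weak_linear_order [set: 'I_n] psi)
  (A_sym : A^T = A)
  (A_ge0 : forall x y : 'I_n, 0 <= A x y)
  (A_ordered : compatible [set: 'I_n] psi [seq [set x] | x <- enum 'I_n]) :
  (forall Phi : seq {set 'I_n},
     robinson A [set: 'I_n] psi (Some Phi) ->
     weak_linear_order [set: 'I_n] Phi /\
     exists phi : nat -> seq {set 'I_n},
       [/\ level_enumerations A phi,
           forall l : nat, (1 <= l <= max_level [set: 'I_n] A)%N ->
             compatible [set: 'I_n] Phi (phi l) &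
           compatible [set: 'I_n] Phi psi])
  /\
  (robinson A [set: 'I_n] psi None ->
     ~ exists phi : nat -> seq {set 'I_n},
       [/\ level_enumerations A phi,
           forall l m : nat, (1 <= l <= max_level [set: 'I_n] A)%N ->
             (1 <= m <= max_level [set: 'I_n] A)%N ->
             compatible [set: 'I_n] (phi l) (phi m) &
           forall l : nat, (1 <= l <= max_level [set: 'I_n] A)%N ->
             compatible [set: 'I_n] (phi l) psi]).
Proof.
split=> [Phi rob|rob [phi [st c cpsi]]].
  have [w r out] := robinson_success rob A_sym A_ge0 psi_wlo erefl.
  split=> //.
  (* Level numbers are taken in a finite ordinal type so that all enumerations can be chosen at
     once; the guard [0 < l] lets [l = 0] receive a dummy value. *)
  have ex (l : 'I_(max_level [set: 'I_n] A).+1) : exists phi, (0 < l)%N ->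
      straight_enumeration [set: 'I_n] (level_graph [set: 'I_n] A l) phi /\
      compatible [set: 'I_n] Phi phi.
    have [l0|l0] := posnP l; first by exists [::]; rewrite l0.
    have lt : 0 < level [set: 'I_n] A l by apply: level_gt0; rewrite // l0 -ltnS ltn_ord.
    by have [phi phiP] := out _ lt; exists phi.
  have [phi phiP] := fin_all_exists ex.
  exists (fun l => phi (inord l)); split=> [l|l|]; last exact: refines_compatible.
    by case/andP=> l0 lm; have [] := phiP (inord l); rewrite inordK.
  by case/andP=> l0 lm; have [] := phiP (inord l); rewrite inordK.
(* A value is numbered by its position in the sorted list of levels; position 0 holds the value 0,
   so positive values get numbers from 1 on. *)
pose idx t := index t (levels [set: 'I_n] A).
have idxP t : t \in levels [set: 'I_n] A -> 0 < t -> (1 <= idx t <= max_level [set: 'I_n] A)%N.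
  move=> tl t0; rewrite (index_level_gt0 A_ge0 t0 tl) /=.
  by rewrite -ltnS prednK ?size_levels_gt0 // index_mem.
apply: (robinson_failure rob A_sym A_ge0 psi_wlo erefl (phi := fun t => phi (idx t))).
split=> [t tl t0|s t sl s0 tl t0|t tl t0].
- by have := st _ (idxP t tl t0); rewrite /level_graph /level nth_index.
- by apply: c; apply: idxP.
- by apply: cpsi; apply: idxP.
Qed.
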